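(* Let $X$ be a Besov space $\dot B^s_{p,a}$ or a Triebel-Lizorkin space $\dot F^s_{p,a}$ on $\mathbb{R}^d$, with $1\le p<\infty$ and $1\le a\le\infty$, and let $Y$ be a function space on $\mathbb{R}^d$ with continuous embedding $X\subset Y$ and with the same scaling: for $r=\frac dp-s$, $\|f(h\,\cdot)\|_X=h^{-r}\|f\|_X$ and $\|f(h\,\cdot)\|_Y=h^{-r}\|f\|_Y$ for every $f$ and every $h>0$. Assume that there exists a wavelet basis $(\psi_\lambda)_{\lambda\in\nabla}$, $\nabla=\mathbb{Z}\times\mathbb{Z}^d$, which is an unconditional basis for both $X$ and $Y$ and for which Assumptions 1 and 2 (both stated in the context) hold. Then there exist $\tau=\tau(X)$, depending only on $X$, and a constant $C$, depending only on $X$ and on the choice of the wavelet basis, such that the following holds. For every bounded sequence $(u_n)_{n>0}$ in $X$, with $K:=\sup_{n>0}\|u_n\|_X$, up to extraction of a subsequence (still denoted $(u_n)_{n>0}$), there exist a family of functions $(\phi^l)_{l>0}$ in $X$ and, for each $l>0$, a sequence of scale-space indices $(\lambda_l(n))_{n>0}$ in $\nabla$ such that, writing for every $L>0$ $$u_n=\sum_{l=1}^L\phi^l_{\lambda_l(n)}+r_{n,L},$$ one has $$\lim_{L\to+\infty}\Bigl(\limsup_{n\to+\infty}\|r_{n,L}\|_Y\Bigr)=0;$$ for any $k\ne l$, as $n\to+\infty$, $$|j(\lambda_k(n))-j(\lambda_l(n))|\to+\infty\quad\text{or}\quad\bigl|k(\lambda_k(n))-2^{j(\lambda_k(n))-j(\lambda_l(n))}k(\lambda_l(n))\bigr|\to+\infty;$$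 and this decomposition is stable in the sense that $$\bigl\|(\|\phi^l\|_X)_{l>0}\bigr\|_{\ell^\tau}\le CK.$$
   Context: **Spaces.** $X$ and $Y$ are homogeneous function spaces on $\mathbb{R}^d$, whose norms are translation invariant in addition to satisfying the scaling identity in the claim. **Indices and rescaling.** $\nabla:=\mathbb{Z}\times\mathbb{Z}^d$. For $\lambda=(j,k)\in\nabla$, write $j(\lambda)=|\lambda|=j$ (scale index) and $k(\lambda)=k$ (space index). For any function $\phi$ and $\lambda=(j,k)$, set $\phi_\lambda:=2^{rj}\phi(2^j\cdot-k)$. **Wavelets.** Wavelet decompositions have the form $f=\sum_{\lambda\in\nabla}d_\lambda\psi_\lambda$ with $\psi_\lambda=2^{rj}\psi(2^j\cdot-k)$ for $\lambda=(j,k)$. With this normalization $\|\psi_\lambda\|_X$ and $\|\psi_\lambda\|_Y$ do not depend on $\lambda$. For $d=1$, $\psi$ is a single function (the mother wavelet). For $d>1$, there are finitely many generating functions $\psi^e$, $e\in E$ ($E$ a finite set), and $\psi=(\psi^e)_{e\in E}$, $\psi_\lambda=(\psi^e_\lambda)_{e\in E}$, $d_\lambda=(d^e_\lambda)_{e\in E}$ are vectors, $d_\lambda\psi_\lambda$ is their finite-dimensional inner product, and $|d_\lambda|$ is the modulus of the vector $d_\lambda$. **Unconditional basis.** $(\psi_\lambda)_{\lambda\in\nabla}$ is an unconditional basis for a space $Z$ (here $Z=X$ and $Z=Y$) if it is a Schauder basis of $Z$ and there is a constant $D$ such that for every finite $F\subset\nabla$ and all coefficients with $|c_\lambda|\le|d_\lambda|$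 for all $\lambda\in F$, $$\Bigl\|\sum_{\lambda\in F}c_\lambda\psi_\lambda\Bigr\|_Z\le D\Bigl\|\sum_{\lambda\in F}d_\lambda\psi_\lambda\Bigr\|_Z .$$ **Nonlinear projector.** For $M>0$ and $f=\sum_{\lambda\in\nabla}d_\lambda\psi_\lambda\in X$, let $Q_Mf:=\sum_{\lambda\in E_M}d_\lambda\psi_\lambda$, where $E_M=E_M(f)\subset\nabla$ has cardinality $M$ and corresponds to the $M$ largest values of $|d_\lambda|$ (an arbitrary choice is made in case of ties). **Assumption 1.** $\displaystyle\lim_{M\to+\infty}\max_{\|f\|_X\le1}\|f-Q_Mf\|_Y=0$ (the max is understood as a supremum). **Assumption 2.** There is a constant $C_0$, depending only on $X$ and on the wavelet basis, such that the following holds. Let $(f_n)_{n>0}$ be uniformly bounded in $X$ with $f_n=\sum_{\lambda\in\nabla}c_{\lambda,n}\psi_\lambda$, and suppose that for every $\lambda$ the sequence $c_{\lambda,n}$ converges to a finite limit $c_\lambda$ as $n\to+\infty$. Then the series $\sum_{\lambda\in\nabla}c_\lambda\psi_\lambda$ converges in $X$ and $$\Bigl\|\sum_{\lambda\in\nabla}c_\lambda\psi_\lambda\Bigr\|_X\le C_0\liminf_{n\to+\infty}\|f_n\|_X .$$ **Wavelet characterization of $X$.** The wavelet basis is assumed to be properly constructed, so that the following norm equivalences hold for $f=\sum_\lambda d_\lambda\psi_\lambda$ with the normalization $\psi_\lambda=2^{rj}\psi(2^j\cdot-k)$ for $\lambda=(j,k)$, $r=\frac dp-s$: $$\|f\|_{\dot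 B^s_{p,a}}\sim\Bigl(\sum_{j\in\mathbb{Z}}\bigl(\sum_{|\lambda|=j}|d_\lambda|^p\bigr)^{a/p}\Bigr)^{1/a},\qquad \|f\|_{\dot F^s_{p,a}}\sim\Bigl\|\bigl(\sum_{\lambda\in\nabla}|d_\lambda\chi_\lambda|^a\bigr)^{1/a}\Bigr\|_{L^p},$$ where $\chi_\lambda=2^{dj/p}\chi(2^j\cdot-k)$, $\chi$ is the indicator function of $[0,1]^d$, and $\lambda=(j,k)$. For $a=\infty$ the usual modification is made; in the Triebel-Lizorkin case the inner expression is replaced by $\sup_{j\in\mathbb{Z}}\sum_{|\lambda|=j}|d_\lambda\chi_\lambda|$. When $\tau=\infty$, the $\ell^\tau$ norm is the supremum. *)

(* Defs.v *)
From HB Require Import structures.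
From mathcomp Require Import all_boot all_order all_algebra.
From mathcomp Require Import finmap complex.
From mathcomp Require Import all_classical all_reals all_analysis.
Set Implicit Arguments. Unset Strict Implicit. Unset Printing Implicit Defensive.
Import Order.TTheory GRing.Theory Num.Theory numFieldNormedType.Exports.
Local Open Scope classical_set_scope.
Local Open Scope ring_scope.

(* Conventions:
   - points of R^d are row vectors ['rV[R]_d];
   - scalars are either real or complex ([scalars]);
   - a function or distribution f on R^d is the functional it induces on real
     test functions, theta |-> <f, theta>; by linearity real test functions
     determine f also when f is complex valued;
   - sequences indexed by n > 0 or l > 0 are indexed by [nat] from 0. *)

Section LebesgueRd.
Variable R : realType.
Let T := measurableTypeR R.

Definition pcons n (x : T * n.-tuple T) : n.+1.-tuple T := [tuple of x.1 :: x.2].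

Lemma measurable_pcons n : measurable_fun [set: T * n.-tuple T] (@pcons n).
Proof. by apply: measurable_cons. Qed.

Section step.
Variables (n : nat) (mu : {sigma_finite_measure set (n.-tuple T) -> \bar R}).
Local Open Scope ereal_scope.

Definition leb_step : set (n.+1.-tuple T) -> \bar R :=
  pushforward (@lebesgue_measure R \x mu) (@pcons n).

Let leb_step0 : leb_step set0 = 0.
Proof. by rewrite /leb_step /pushforward preimage_set0 measure0. Qed.

Let leb_step_ge0 A : 0 <= leb_step A.
Proof. by apply: integral_ge0 => // *. Qed.

Let leb_step_sigma_additive : semi_sigma_additive leb_step.
Proof.
move=> F mF tF mUF; rewrite /leb_step /pushforward preimage_bigcup.
have mp A : measurable A -> measurable (@pcons n @^-1` A).
  by move=> mA; rewrite -[X in measurable X]setTI; exact: measurable_pcons.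
apply: measure_semi_sigma_additive.
- by move=> k; exact: mp.
- apply/trivIsetP => /= i j _ _ ij; rewrite -preimage_setI.
  by move/trivIsetP : tF => /(_ _ _ _ _ ij) ->//; rewrite preimage_set0.
- by rewrite -preimage_bigcup; exact: mp.
Qed.

HB.instance Definition _ := isMeasure.Build _ _ _
  leb_step leb_step0 leb_step_ge0 leb_step_sigma_additive.

Let leb_step_sigma_finite : sigma_finite setT leb_step.
Proof.
have /sigma_finiteP[F [TF ndF Foo]] := sigma_finiteT (@lebesgue_measure R).
have /sigma_finiteP[G [TG ndG Goo]] := sigma_finiteT mu.
pose g (t : n.+1.-tuple T) : T * n.-tuple T := (thead t, [tuple of behead t]).
have gK : cancel (@pcons n) g.
  by move=> [x t]; congr pair; apply/val_inj.
have mg : measurable_fun [set: n.+1.-tuple T] g.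
  apply: (measurable_fun_pair _ (@measurable_behead _ T n)) => //.
  exact: measurable_tnth.
exists (fun k => g @^-1` (F k `*` G k)).
  rewrite -preimage_bigcup (_ : \bigcup_k _ = setT) ?preimage_setT//.
  rewrite -subTset => -[x t] _.
  have [k _ Fk] : (\bigcup_i F i) x by rewrite -TF.
  have [l _ Gl] : (\bigcup_i G i) t by rewrite -TG.
  exists (maxn k l) => //; split => /=.
    by move: x Fk; exact/subsetPset/ndF/leq_maxl.
  by move: t Gl; exact/subsetPset/ndG/leq_maxr.
move=> k; have [mF Fk] := Foo k; have [mG Gk] := Goo k; split.
  by rewrite -[X in measurable X]setTI; apply: mg => //; exact: measurableX.
rewrite /leb_step /pushforward -comp_preimage.
rewrite (_ : g \o _ = id); last by apply/funext => x /=; rewrite gK.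
by rewrite preimage_id product_measure1E// lte_mul_pinfty// ge0_fin_numE.
Qed.

HB.instance Definition _ := Measure_isSigmaFinite.Build _ _ _
  leb_step leb_step_sigma_finite.
End step.

(* Lebesgue measure on R^n, as iterated product of the one on R. *)
Fixpoint leb n : {sigma_finite_measure set (n.-tuple T) -> \bar R} :=
  if n is n'.+1 then leb_step (leb n') else \d_([tuple] : 0.-tuple T).

End LebesgueRd.

Section Scalars.
Variable R : realType.

Variant scalars := RealScalars | ComplexScalars.

Definition scalar (c : scalars) : fieldType :=
  match c with RealScalars => R | ComplexScalars => complex R end.

Definition of_real (c : scalars) : R -> scalar c :=
  match c return R -> scalar c with
  | RealScalars => id
  | ComplexScalars => fun x => Complex x 0
  end.

Definition modulus (c : scalars) : scalar c -> R :=
  match c return scalar c -> R with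
  | RealScalars => fun x => `|x|
  | ComplexScalars => fun z => Num.sqrt (complex.Re z ^+ 2 + complex.Im z ^+ 2)
  end.

(* The ell^q norm of a family of nonnegative extended reals, 1 <= q <= +oo. *)
Definition lnorm (I : choiceType) (q : \bar R) (x : I -> \bar R) : \bar R :=
  match q with
  | t%:E => ((\esum_(i in [set: I]) (x i `^ t)) `^ t^-1)%E
  | _ => ereal_sup (range x)
  end.

End Scalars.
Arguments of_real {R}.
Arguments modulus {R c}.

Definition nabla (d : nat) : choiceType := (int * 'rV[int]_d)%type.

Section FunctionSpaces.
Variables (R : realType) (d : nat) (c : scalars).
Let K := scalar R c.

Definition rvec (t : d.-tuple (measurableTypeR R)) : 'rV[R]_d :=
  \row_i tnth t i.

Definition enorm (x : 'rV[R]_d) : R := Num.sqrt (\sum_(i < d) x 0 i ^+ 2).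

Definition dotv (x y : 'rV[R]_d) : R := \sum_(i < d) x 0 i * y 0 i.

Definition pderiv (al : seq 'I_d) (theta : 'rV[R]_d -> R) : 'rV[R]_d -> R :=
  foldr (fun i g => 'D_(delta_mx 0 i) g) theta al.

Definition schwartz (theta : 'rV[R]_d -> R) : Prop :=
  (forall al x, differentiable (pderiv al theta) x) /\
  (forall al (N : nat), exists B, forall x,
     (1 + enorm x) ^+ N * `|pderiv al theta x| <= B).

Definition distr : Type := ('rV[R]_d -> R) -> (K^o).

(* The value 0 off the Schwartz class is a normal form, so that two tempered
   distributions are equal exactly when they agree on Schwartz functions. The
   third clause is continuity for the Schwartz seminorms. *)
Definition tempered (f : distr) : Prop :=
  [/\ forall theta, ~ schwartz theta -> f theta = 0,
      forall b theta eta, schwartz theta -> schwartz eta ->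
        f (fun x => b * theta x + eta x) = of_real c b * f theta + f eta
    & exists (N : nat) (B : R), forall theta b, schwartz theta ->
        (forall al x, (size al <= N)%N ->
           (1 + enorm x) ^+ N * `|pderiv al theta x| <= b) ->
        modulus (f theta) <= B * b].

Definition polynomial_distr (f : distr) : Prop :=
  tempered f /\
  exists ms : seq (K * ('I_d -> nat)), forall theta, schwartz theta ->
    f theta = \sum_(m <- ms) m.1 *
      of_real c (\int[@leb R d]_t
        (\prod_(i < d) tnth t i ^+ m.2 i * theta (rvec t))).

(* f(h .) and f(. - y). *)
Definition dilate (h : R) (f : distr) : distr :=
  fun theta => of_real c (h ^- d) * f (fun x => theta (h^-1 *: x)).

Definition translate (y : 'rV[R]_d) (f : distr) : distr :=
  fun theta => f (fun x => theta (x + y)).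

Definition intvec (k : 'rV[int]_d) : 'rV[R]_d := map_mx intr k.

(* phi_lambda = 2^(rj) phi(2^j . - k) for lambda = (j, k). *)
Definition rescale (r : R) (phi : distr) (lambda : nabla d) : distr :=
  (of_real c (2 `^ (r * lambda.1%:~R))) *:
    dilate (2 ^ lambda.1) (translate (intvec lambda.2) phi).

Record fspace := FSpace {
  fdom : set distr;
  fnorm : distr -> R
}.

(* Homogeneous function spaces are identified modulo polynomials in some
   conventions and realized in S' in others. Both are covered: the norm is a
   seminorm on a subspace of S', whose null elements are polynomials. *)
Definition function_space (r : R) (Z : fspace) : Prop :=
  [/\ [/\ fdom Z `<=` tempered, fdom Z 0
         & forall b f g, fdom Z f -> fdom Z g -> fdom Z (b *: f + g)],
      [/\ forall f g, fdom Z f -> fdom Z g ->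
             fnorm Z (f + g) <= fnorm Z f + fnorm Z g,
          forall (b : K) f, fdom Z f -> fnorm Z (b *: f) = modulus b * fnorm Z f
        & forall f, fdom Z f -> fnorm Z f = 0 -> polynomial_distr f],
      forall y f, fdom Z f ->
        fdom Z (translate y f) /\ fnorm Z (translate y f) = fnorm Z f
    & forall h f, 0 < h -> fdom Z f ->
        fdom Z (dilate h f) /\ fnorm Z (dilate h f) = h `^ (- r) * fnorm Z f].

Definition complete_space (Z : fspace) : Prop :=
  forall f : nat -> distr, (forall n, fdom Z (f n)) ->
    (forall e, 0 < e -> exists N : nat, forall m n, (N <= m)%N -> (N <= n)%N ->
       fnorm Z (f m - f n) < e) ->
    exists2 g, fdom Z g & (fun n => fnorm Z (f n - g)) @ \oo --> (0 : R).

Definition embedded (X Y : fspace) : Prop :=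
  fdom X `<=` fdom Y /\
  exists A : R, forall f, fdom X f -> fnorm Y f <= A * fnorm X f.

Variant space_family := Besov | TriebelLizorkin.

(* The Fourier transform of an even real function is the cosine transform. *)
Definition fourier_even (phi : 'rV[R]_d -> R) (xi : 'rV[R]_d) : R :=
  \int[@leb R d]_t (cos (dotv (rvec t) xi) * phi (rvec t)).

(* Kernel of the Littlewood-Paley block Delta_0; in the last clause only
   finitely many terms are nonzero. *)
Definition littlewood_paley (phi : 'rV[R]_d -> R) : Prop :=
  [/\ schwartz phi, forall x, phi (- x) = phi x,
      forall xi, enorm xi < 1 / 2 \/ 2 < enorm xi -> fourier_even phi xi = 0
    & forall xi, xi != 0 ->
        \sum_(j \in [set: int]) fourier_even phi (2 ^ (- j) *: xi) = 1].

(* (Delta_j f)(x) = 2^(jd) (phi(2^j .) * f)(x). *)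
Definition lp_block (phi : 'rV[R]_d -> R) (j : int) (f : distr)
    (x : 'rV[R]_d) : K :=
  f (fun y => (2 ^ j) ^+ d * phi (2 ^ j *: (x - y))).

Definition homogeneous_norm (fam : space_family) (phi : 'rV[R]_d -> R)
    (s p : R) (a : \bar R) (f : distr) : \bar R :=
  match fam with
  | Besov => lnorm a (fun j : int => ((2 `^ (j%:~R * s))%:E *
      Lnorm (@leb R d) p%:E
        (fun t => (modulus (lp_block phi j f (rvec t)))%:E))%E)
  | TriebelLizorkin => Lnorm (@leb R d) p%:E (fun t => lnorm a (fun j : int =>
      (2 `^ (j%:~R * s) * modulus (lp_block phi j f (rvec t)))%:E))
  end.

(* Z is dot B^s_(p,a) or dot F^s_(p,a), in some equivalent norm: the usual
   Littlewood-Paley norm is homogeneous for dyadic dilations only. *)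
Definition homogeneous_space (fam : space_family) (s p : R) (a : \bar R)
    (Z : fspace) : Prop :=
  complete_space Z /\
  exists2 phi, littlewood_paley phi &
    (exists2 A : R, 0 < A & forall f, fdom Z f ->
       (homogeneous_norm fam phi s p a f <= (A * fnorm Z f)%:E)%E /\
       ((fnorm Z f)%:E <= A%:E * homogeneous_norm fam phi s p a f)%E) /\
    (forall f, tempered f -> (homogeneous_norm fam phi s p a f < +oo)%E ->
       exists2 P, polynomial_distr P & fdom Z (f - P)).

End FunctionSpaces.

Section Wavelets.
Variables (R : realType) (d : nat) (c : scalars) (r : R) (E : finType).
Let K := scalar R c.
Let distr := distr R d c.
Let coeffs := nabla d -> E -> K.
Variable psi : E -> distr.

Definition vmod (v : E -> K) : R := Num.sqrt (\sum_(e : E) modulus (v e) ^+ 2).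

(* The inner product d_lambda psi_lambda. *)
Definition wterm (b : coeffs) (lambda : nabla d) : distr :=
  \sum_(e : E) b lambda e *: rescale r (psi e) lambda.

Definition wsum (b : coeffs) (F : {fset nabla d}) : distr :=
  \sum_(lambda <- enum_fset F) wterm b lambda.

(* f = sum_(lambda in nabla) d_lambda psi_lambda in Z, along the net of finite
   subsets of nabla. *)
Definition expansion (Z : fspace R d c) (f : distr) (b : coeffs) : Prop :=
  forall eps : R, 0 < eps -> exists F0 : {fset nabla d},
    forall F : {fset nabla d}, (F0 `<=` F)%fset -> fnorm Z (f - wsum b F) < eps.

Definition schauder_basis (Z : fspace R d c) : Prop :=
  (forall e lambda, fdom Z (rescale r (psi e) lambda)) /\
  (forall f, fdom Z f -> exists! b : coeffs, expansion Z f b).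

Definition unconditional_basis (Z : fspace R d c) : Prop :=
  schauder_basis Z /\
  exists D : R, forall (F : {fset nabla d}) (b b' : coeffs),
    (forall lambda, lambda \in F -> vmod (b lambda) <= vmod (b' lambda)) ->
    fnorm Z (wsum b F) <= D * fnorm Z (wsum b' F).

(* Q selects, for every M and f, a set of M largest coefficients. *)
Definition nonlinear_projector (X : fspace R d c)
    (Q : nat -> distr -> distr) : Prop :=
  forall M f, fdom X f -> forall b, expansion X f b ->
    exists EM : {fset nabla d},
      [/\ #|` EM| = M,
          forall lambda mu, lambda \in EM -> mu \notin EM ->
            vmod (b mu) <= vmod (b lambda)
        & Q M f = wsum b EM].

Definition assumption1 (X Y : fspace R d c) (Q : nat -> distr -> distr) : Prop :=
  (fun M : nat => ereal_sup [set (fnorm Y (f - Q M f))%:E |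
     f in [set f | fdom X f /\ fnorm X f <= 1]]) @ \oo --> (0 : \bar R).

Definition assumption2 (X : fspace R d c) : Prop :=
  exists C0 : R, forall (f : nat -> distr) (b : nat -> coeffs) (b0 : coeffs),
    (forall n, fdom X (f n)) ->
    (exists B, forall n, fnorm X (f n) <= B) ->
    (forall n, expansion X (f n) (b n)) ->
    (forall lambda e,
       (fun n => modulus (b n lambda e - b0 lambda e)) @ \oo --> (0 : R)) ->
    exists g, [/\ fdom X g, expansion X g b0
      & ((fnorm X g)%:E <= C0%:E * limn_einf (fun n => (fnorm X (f n))%:E))%E].

(* chi_lambda = 2^(dj/p) chi(2^j . - k), with chi the indicator of [0,1]^d. *)
Definition chi (p : R) (lambda : nabla d) (x : 'rV[R]_d) : R :=
  let y := 2 ^ lambda.1 *: x - intvec R lambda.2 in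
  2 `^ (d%:R * lambda.1%:~R / p) * [forall i, 0 <= y 0 i <= 1]%:R.

Definition wavelet_norm (fam : space_family) (p : R) (a : \bar R) (b : coeffs)
    : \bar R :=
  match fam with
  | Besov => lnorm a (fun j : int =>
      lnorm p%:E (fun k : 'rV[int]_d => (vmod (b (j, k)))%:E))
  | TriebelLizorkin => Lnorm (@leb R d) p%:E (fun t =>
      let term lambda := (vmod (b lambda) * chi p lambda (rvec t))%:E in
      match a with
      | q%:E => lnorm q%:E term
      | _ => ereal_sup (range (fun j : int =>
               \esum_(k in [set: 'rV[int]_d]) term (j, k)))
      end)
  end.

Definition wavelet_characterization (fam : space_family) (p : R) (a : \bar R)
    (X : fspace R d c) : Prop :=
  exists2 A : R, 0 < A & forall f b, fdom X f -> expansion X f b ->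
    (wavelet_norm fam p a b <= (A * fnorm X f)%:E)%E /\
    ((fnorm X f)%:E <= A%:E * wavelet_norm fam p a b)%E.

Definition remainder (u : nat -> distr) (phi : nat -> distr)
    (lam : nat -> nat -> nabla d) (n L : nat) : distr :=
  u n - \sum_(l < L) rescale r (phi l) (lam l n).

Definition orthogonal_indices (lam1 lam2 : nat -> nabla d) : Prop :=
  ((fun n => `|(lam1 n).1%:~R - (lam2 n).1%:~R| : R) @ \oo --> +oo) \/
  ((fun n => enorm (intvec R (lam1 n).2 -
      2 ^ ((lam1 n).1 - (lam2 n).1) *: intvec R (lam2 n).2)) @ \oo --> +oo).

End Wavelets.

(* Main.v *)
Require Import Defs.
From HB Require Import structures.
From mathcomp Require Import all_boot all_order all_algebra.
From mathcomp Require Import finmap complex.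
From mathcomp Require Import all_classical all_reals all_analysis.
From mathcomp Require Import lra ring zify.

(** Order the wavelet coefficients of each [u n] by decreasing modulus. By
    Assumption 1 the sum of the first [M] terms approximates [u n] in [Y],
    uniformly in [n], when [M] tends to infinity ([greedy_error]). After a diagonal
    extraction ([extraction]) the coefficient of each rank [m] converges, and the
    positions of the wavelets of any two ranks are either orthogonal or [merged],
    that is, in an eventually constant relative position. Merging is an equivalence
    relation, and each of its classes gives one profile: the sum of the limits of
    the terms of the class, all seen from the track of its least rank, the [root].

    The point is the convergence of this sum in [X]. A term whose wavelet is coarser
    than the one of its root is seen at a dyadic, not integral, position, so that
    its limit (a [piece]) is in general no wavelet of the basis, and Assumption 2
    says nothing about sums of pieces. However, finitely many pieces of one class
    are, up to an error that vanishes with [n], a rescaled wavelet sum, so that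
    inequalities between norms of finite wavelet sums pass to pieces. The one that
    is needed is the lower estimate, with [tau = max p a]: the sum of the [tau]-th
    powers of the norms of disjoint blocks is at most a constant times the [tau]-th
    power of the norm of their sum. It follows from the wavelet characterization of
    [X], which expresses the norm through a power of a sum over wavelets,
    itself summed over scales or integrated over space, by the reverse Minkowski inequality ([reverse_minkowski],
    [wavelet_norm_parts], [lower_estimate_finite]). It
    serves twice: blocks of a bounded sequence of partial sums cannot stay away from 0
    ([partial_cauchy]), and the norms of the profiles are bounded in [ell^tau]
    ([profiles_stable]).

    For [a = +oo] there is no lower estimate, but then a single generator yields
    a bounded sequence of wavelet sums whose blocks do not tend to 0, which
    contradicts Assumption 2 ([besov_infty], [triebel_infty]).

    The remainder after [L] profiles contains only terms of rank at least [L],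
    besides errors that vanish with [n] or with the truncation of the profiles.
    Unconditionality in [Y] bounds it by the greedy error at rank [L]
    ([remainder_small]). *)

Set Implicit Arguments. Unset Strict Implicit. Unset Printing Implicit Defensive.
Import Order.TTheory GRing.Theory Num.Theory numFieldNormedType.Exports.
Local Open Scope classical_set_scope.
Local Open Scope ring_scope.

(** * Scalars and the rescaling of distributions *)

Section ScalarTheory.
Variables (R : realType) (c : scalars).
Implicit Types (x y : R) (z w : Defs.scalar R c).

Lemma of_realM x y : of_real c (x * y) = of_real c x * of_real c y.
Proof.
by case: c => //=; apply/eqP; rewrite eq_complex/= !mulr0 mul0r subr0 addr0 !eqxx.
Qed.

Lemma of_real1 : of_real c (1 : R) = 1. Proof. by case: c. Qed.

Lemma modulus_of_real x : modulus (of_real c x) = `|x|.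
Proof. by case: c => //=; rewrite expr0n/= addr0 sqrtr_sqr. Qed.

Lemma modulus_normc (z : complex R) :
  @modulus R ComplexScalars z = complex.Re `|z|.
Proof. by case: z => a b; rewrite normc_def. Qed.

Lemma modulus_ge0 z : 0 <= modulus z.
Proof. by case: c z => //= z; rewrite sqrtr_ge0. Qed.

Lemma modulus0 : modulus (0 : Defs.scalar R c) = 0.
Proof. by case: c => /=; rewrite ?normr0// expr0n/= addr0 sqrtr0. Qed.

Lemma modulusM z w : modulus (z * w) = modulus z * modulus w.
Proof.
case: c z w => [z w|z w]; first exact: normrM.
by rewrite [LHS]modulus_normc normrM !modulus_normc; case: z w => a b [e f];
  rewrite !normc_def/= mulr0 subr0.
Qed.

Lemma modulusN z : modulus (- z) = modulus z.
Proof.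
case: c z => [z|z]; first exact: normrN.
by rewrite [LHS]modulus_normc normrN -modulus_normc.
Qed.

Lemma modulus_eq0 z : modulus z = 0 -> z = 0.
Proof.
case: c z => [z|[x y]]; first exact: normr0_eq0.
by move=> /(@ComplexField.Normc.eq0_normc R (Complex x y)).
Qed.

End ScalarTheory.

Section Placement.
Variables (R : realType) (d : nat) (c : scalars) (r : R).
Implicit Types (f g : distr R d c) (y : 'rV[R]_d).

(** Rescaling to an arbitrary real space index [y]. Profiles force this
    generality: seen from one wavelet, a coarser wavelet sits at a dyadic
    position. *)
Definition place (j : int) y f : distr R d c :=
  of_real c (2 `^ (r * j%:~R)) *: dilate (2 ^ j) (translate y f).

Lemma rescaleE f lam : rescale r f lam = place lam.1 (intvec R lam.2) f.
Proof. by []. Qed.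

Lemma placeE j y f theta : place j y f theta =
  of_real c (2 `^ (r * j%:~R)) *
    (of_real c ((2 ^ j) ^- d) * f (fun x => theta ((2 ^ j)^-1 *: (x + y)))).
Proof. by []. Qed.

Lemma placeD j y f g : place j y (f + g) = place j y f + place j y g.
Proof. by apply/funext => theta; rewrite /GRing.add/= !placeE -!mulrDr. Qed.

Lemma placeZ j y b f : place j y (b *: f) = b *: place j y f.
Proof.
apply/funext => theta.
rewrite placeE [(b *: f) _]/(b * _) [RHS]/(b * place j y f theta) placeE.
by rewrite mulrCA [X in _ * X]mulrCA mulrCA [X in _ * X = _]mulrCA.
Qed.

Lemma place0 j y : place j y 0 = 0.
Proof. by rewrite -(scale0r 0) placeZ !scale0r. Qed.

Lemma placeN j y f : place j y (- f) = - place j y f.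
Proof. by rewrite -scaleN1r placeZ scaleN1r. Qed.

Lemma place_sum j y I (s : seq I) (P : pred I) (F : I -> distr R d c) :
  place j y (\sum_(i <- s | P i) F i) = \sum_(i <- s | P i) place j y (F i).
Proof.
elim/big_rec2 : _ => [|i h h' _ <-]; first exact: place0.
exact: placeD.
Qed.

Lemma place_place j1 y1 j2 y2 f :
  place j1 y1 (place j2 y2 f) = place (j1 + j2) (y2 + 2 ^ j2 *: y1) f.
Proof.
apply/funext => theta; rewrite !placeE.
set F1 := (fun x => _); set F2 := (fun x => _).
have unit2 : (2 : R) \is a GRing.unit by rewrite unitfE pnatr_eq0.
have -> : F1 = F2.
  apply/funext => x; rewrite /F1 /F2; congr theta.
  rewrite addrA [in RHS]scalerDr !scalerDr !scalerA expfzDr// invfM.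
  by rewrite divfK ?expfz_neq0.
have -> : (2 : R) ^ (j1 + j2) = 2 ^ j1 * 2 ^ j2 by rewrite expfzDr.
have -> : (2 : R) `^ (r * (j1 + j2)%:~R) = 2 `^ (r * j1%:~R) * 2 `^ (r * j2%:~R).
  by rewrite intrD mulrDr powRD// (_ : (2 : R) != 0) ?implybT// pnatr_eq0.
rewrite !of_realM exprMn invfM !of_realM; ring.
Qed.

Lemma rescaleB f g lam : rescale r (f - g) lam = rescale r f lam - rescale r g lam.
Proof. by rewrite (rescaleE (f - g)) placeD placeN. Qed.

Lemma rescale0 lam : rescale r 0 lam = 0 :> distr R d c.
Proof. by rewrite rescaleE place0. Qed.

End Placement.

(** * Norms invariant under rescaling *)

Section SpaceTheory.
Variables (R : realType) (d : nat) (c : scalars) (r : R) (Z : fspace R d c).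
Hypothesis HZ : function_space r Z.
Local Notation K := (Defs.scalar R c).
Implicit Types (f g : distr R d c).

Lemma fdom0 : fdom Z 0. Proof. by case: HZ => -[]. Qed.

Lemma fdomP (b : K) f g : fdom Z f -> fdom Z g -> fdom Z (b *: f + g).
Proof. by case: HZ => -[_ _ H] _ _ _; exact: H. Qed.

Lemma fdomZ (b : K) f : fdom Z f -> fdom Z (b *: f).
Proof. by move=> Hf; rewrite -[_ *: _]addr0; apply: fdomP => //; exact: fdom0. Qed.

Lemma fdomD f g : fdom Z f -> fdom Z g -> fdom Z (f + g).
Proof. by move=> Hf; rewrite -[X in X + _]scale1r; exact: fdomP. Qed.

Lemma fdomN f : fdom Z f -> fdom Z (- f).
Proof. by move=> Hf; rewrite -scaleN1r; exact: fdomZ. Qed.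

Lemma fdomB f g : fdom Z f -> fdom Z g -> fdom Z (f - g).
Proof. by move=> Hf Hg; apply: fdomD => //; exact: fdomN. Qed.

Lemma fdom_sum I (s : seq I) (P : pred I) (F : I -> distr R d c) :
  (forall i, P i -> fdom Z (F i)) -> fdom Z (\sum_(i <- s | P i) F i).
Proof.
by move=> H; elim/big_ind : _ => //; [exact: fdom0|exact: fdomD].
Qed.

Lemma fnormD f g : fdom Z f -> fdom Z g ->
  fnorm Z (f + g) <= fnorm Z f + fnorm Z g.
Proof. by case: HZ => _ [H _ _] _ _; exact: H. Qed.

Lemma fnormZ (b : K) f : fdom Z f -> fnorm Z (b *: f) = modulus b * fnorm Z f.
Proof. by case: HZ => _ [_ H _] _ _; exact: H. Qed.

Lemma fnorm0 : fnorm Z 0 = 0.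
Proof. by rewrite -(scale0r 0) fnormZ ?modulus0 ?mul0r//; exact: fdom0. Qed.

Lemma fnormN f : fdom Z f -> fnorm Z (- f) = fnorm Z f.
Proof.
by move=> Hf; rewrite -scaleN1r fnormZ// modulusN -(of_real1 R) modulus_of_real
  normr1 mul1r.
Qed.

Lemma fnorm_ge0 f : fdom Z f -> 0 <= fnorm Z f.
Proof.
move=> Hf; have := fnormD Hf (fdomN Hf).
by rewrite subrr fnorm0 fnormN// -mulr2n pmulrn_lge0.
Qed.

Lemma fnormB f g : fdom Z f -> fdom Z g ->
  fnorm Z (f - g) <= fnorm Z f + fnorm Z g.
Proof. by move=> Hf Hg; rewrite -(fnormN Hg); apply: fnormD => //; exact: fdomN. Qed.

Lemma fnorm_distC f g : fdom Z f -> fdom Z g -> fnorm Z (f - g) = fnorm Z (g - f).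
Proof. by move=> Hf Hg; rewrite -fnormN ?opprB//; exact: fdomB. Qed.

Lemma fnorm_sub_le f g : fdom Z f -> fdom Z g ->
  fnorm Z f <= fnorm Z g + fnorm Z (f - g).
Proof.
move=> Hf Hg; have := fnormD Hg (fdomB Hf Hg); by rewrite (subrKC g f).
Qed.

Lemma fnorm_sum I (s : seq I) (P : pred I) (F : I -> distr R d c) :
  (forall i, P i -> fdom Z (F i)) ->
  fnorm Z (\sum_(i <- s | P i) F i) <= \sum_(i <- s | P i) fnorm Z (F i).
Proof.
move=> H; suff: fdom Z (\sum_(i <- s | P i) F i) /\
    fnorm Z (\sum_(i <- s | P i) F i) <= \sum_(i <- s | P i) fnorm Z (F i) by case.
elim/big_rec2 : _ => [|i x g Pi [Hg gx]]; first by rewrite fnorm0; split => //; exact: fdom0.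
split; first by apply: fdomD => //; exact: H.
by rewrite (le_trans (fnormD _ _))// ?lerD2l//; exact: H.
Qed.

(** The weights of [place] undo the scaling of the norm. *)
Lemma place_norm j y f : fdom Z f ->
  fdom Z (place r j y f) /\ fnorm Z (place r j y f) = fnorm Z f.
Proof.
move=> Hf; case: HZ => _ _ Ht Hd.
have [Htf Ntf] := Ht y _ Hf.
have h0 : (0 : R) < 2 ^ j by rewrite exprz_gt0.
have [Hdf Ndf] := Hd _ _ h0 Htf.
split; first exact: fdomZ.
rewrite fnormZ// modulus_of_real Ndf Ntf mulrA ger0_norm ?powR_ge0//.
rewrite -powR_intmul// -powRrM mulrN powRN mulrC [r * _]mulrC mulfV ?mulr1//.
Qed.

Lemma rescale_dom f lam : fdom Z f -> fdom Z (rescale r f lam).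
Proof. by move=> /(place_norm lam.1 (intvec R lam.2))[]. Qed.

Lemma rescale_norm f lam : fdom Z f -> fnorm Z (rescale r f lam) = fnorm Z f.
Proof. by move=> /(place_norm lam.1 (intvec R lam.2))[]. Qed.

End SpaceTheory.

(** * Wavelet sums and unconditionality *)

Section VectorModulus.
Variables (R : realType) (c : scalars) (E : finType).
Local Notation K := (Defs.scalar R c).
Implicit Types v : E -> K.

Lemma vmod_ge0 v : 0 <= vmod v. Proof. exact: sqrtr_ge0. Qed.

Lemma modulus_le_vmod v e : modulus (v e) <= vmod v.
Proof.
rewrite /vmod -[X in X <= _]ger0_norm ?modulus_ge0// -sqrtr_sqr ler_wsqrtr//.
by rewrite (bigD1 e)//= lerDl sumr_ge0// => i _; rewrite sqr_ge0.
Qed.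

Lemma vmod0 : vmod (0 : E -> K) = 0.
Proof.
rewrite /vmod big1 ?sqrtr0// => e _.
by rewrite -[X in modulus X]/(0 : K) modulus0 expr0n.
Qed.

Lemma vmod_eq0 v : vmod v = 0 -> v = 0.
Proof.
move=> v0; apply/funext => e; apply: modulus_eq0.
by apply/eqP; rewrite eq_le modulus_ge0 -v0 modulus_le_vmod.
Qed.

Lemma vmodZ (x : K) v : vmod (fun e => x * v e) = modulus x * vmod v.
Proof.
rewrite /vmod -[X in X * _]ger0_norm ?modulus_ge0// -sqrtr_sqr -sqrtrM ?sqr_ge0//.
by congr Num.sqrt; rewrite mulr_sumr; apply: eq_bigr => e _; rewrite modulusM exprMn.
Qed.

End VectorModulus.

Section Expansions.
Variables (R : realType) (d : nat) (c : scalars) (r : R) (E : finType).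
Variable psi : E -> distr R d c.
Local Notation K := (Defs.scalar R c).
Local Notation coeffs := (nabla d -> E -> K).
Implicit Types (b : coeffs) (F G : {fset nabla d}) (lam mu : nabla d).
Local Notation wsum := (wsum r psi).
Local Notation wterm := (wterm r psi).

Definition coeffs_on b F : coeffs := fun lam => if lam \in F then b lam else 0.

Lemma wterm_eq b b' lam : b lam = b' lam -> wterm b lam = wterm b' lam.
Proof. by rewrite /Defs.wterm => ->. Qed.

Lemma wterm0 b lam : b lam = 0 -> wterm b lam = 0.
Proof. by rewrite /Defs.wterm => ->; rewrite big1// => e _; rewrite scale0r. Qed.

Lemma wtermD b b' lam : wterm (b + b') lam = wterm b lam + wterm b' lam.
Proof.
by rewrite /Defs.wterm -big_split; apply: eq_bigr => e _; exact: scalerDl.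
Qed.

Lemma wtermZ (x : K) b lam :
  wterm (fun lam e => x * b lam e) lam = x *: wterm b lam.
Proof.
by rewrite /Defs.wterm scaler_sumr; apply: eq_bigr => e _; rewrite scalerA.
Qed.

Lemma eq_wsum b b' F : {in F, b =1 b'} -> wsum b F = wsum b' F.
Proof.
by move=> bb'; rewrite /Defs.wsum !big_seq; apply: eq_bigr => lam /bb'/wterm_eq.
Qed.

Lemma wsumD b b' F : wsum (b + b') F = wsum b F + wsum b' F.
Proof. by rewrite /Defs.wsum -big_split; apply: eq_bigr => lam _; exact: wtermD. Qed.

Lemma wsumZ (x : K) b F : wsum (fun lam e => x * b lam e) F = x *: wsum b F.
Proof. by rewrite /Defs.wsum scaler_sumr; apply: eq_bigr => lam _; exact: wtermZ. Qed.

Lemma wsum_seq b F (s : seq (nabla d)) : uniq s -> F =i s ->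
  wsum b F = \sum_(lam <- s) wterm b lam.
Proof.
move=> us Fs; rewrite /Defs.wsum; apply: perm_big; exact: uniq_perm.
Qed.

Lemma wsumU b F G : [disjoint F & G]%fset ->
  wsum b (F `|` G)%fset = wsum b F + wsum b G.
Proof.
move=> FG; rewrite (@wsum_seq _ _ (enum_fset F ++ enum_fset G)) ?big_cat//.
  rewrite cat_uniq !fset_uniq andbT/=; apply/hasPn => lam lG.
  by apply: (contraTN _ lG) => lF; exact: (fdisjointP FG).
by move=> lam; rewrite in_fsetU mem_cat.
Qed.

Lemma wsum_on b F G : wsum (coeffs_on b F) G = wsum b (F `&` G)%fset.
Proof.
rewrite [RHS](@wsum_seq _ _ [seq lam <- enum_fset G | lam \in F]).
- rewrite big_filter /Defs.wsum [LHS](bigID (fun lam => lam \in F))/=.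
  rewrite [X in _ + X]big1 => [|lam /negbTE lF]; last first.
    by apply: wterm0; rewrite /coeffs_on lF.
  by rewrite addr0; apply: eq_bigr => lam lF; apply: wterm_eq; rewrite /coeffs_on lF.
- by rewrite filter_uniq ?fset_uniq.
- by move=> lam; rewrite in_fsetI mem_filter.
Qed.

Lemma wsum_fset1 b lam : wsum b [fset lam]%fset = wterm b lam.
Proof.
rewrite (@wsum_seq _ _ [:: lam]) ?big_seq1// => mu.
by rewrite in_fset1 inE.
Qed.

Definition single (e0 : E) (h : nabla d -> R) : coeffs :=
  fun lam e => of_real c (h lam) * (e == e0)%:R.

Lemma vmod_single e0 h lam : vmod (single e0 h lam) = `|h lam|.
Proof.
rewrite vmodZ modulus_of_real; suff -> : vmod (fun e => (e == e0)%:R : K) = 1.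
  by rewrite mulr1.
rewrite /vmod (bigD1 e0)//= big1 => [|e /negbTE ->]; last by rewrite modulus0 expr0n.
by rewrite eqxx -(of_real1 R) modulus_of_real normr1 expr1n addr0 sqrtr1.
Qed.

Lemma wterm_single e0 h lam :
  wterm (single e0 h) lam = of_real c (h lam) *: rescale r (psi e0) lam.
Proof.
rewrite /Defs.wterm (bigD1 e0)//= big1 => [|e /negbTE e0e].
  by rewrite addr0 /single eqxx mulr1.
by rewrite /single e0e mulr0 scale0r.
Qed.

Section InSpace.
Variable Z : fspace R d c.
Hypothesis HZ : function_space r Z.
Hypothesis psiZ : forall e lam, fdom Z (rescale r (psi e) lam).

Lemma wterm_dom b lam : fdom Z (wterm b lam).
Proof. by apply: (fdom_sum HZ) => e _; exact: (fdomZ HZ). Qed.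

Lemma wsum_dom b F : fdom Z (wsum b F).
Proof. by apply: (fdom_sum HZ) => e _; exact: wterm_dom. Qed.

Lemma expansion_wsum b F : expansion r psi Z (wsum b F) (coeffs_on b F).
Proof.
move=> eps eps0; exists F => G FG.
by rewrite wsum_on (fsetIidPl FG) subrr (fnorm0 HZ).
Qed.

Lemma expansionD f g b b' : fdom Z f -> fdom Z g ->
  expansion r psi Z f b -> expansion r psi Z g b' ->
  expansion r psi Z (f + g) (b + b').
Proof.
move=> fZ gZ fb gb' eps eps0; have e20 : 0 < eps / 2 by rewrite divr_gt0.
have [F0 HF] := fb _ e20; have [G0 HG] := gb' _ e20.
exists (F0 `|` G0)%fset => F FG.
rewrite wsumD opprD addrACA (splitr eps).
apply: le_lt_trans (ltrD (HF F _) (HG F _)).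
- by apply: (fnormD HZ); apply: (fdomB HZ) => //; exact: wsum_dom.
- by rewrite (fsubset_trans _ FG)// fsubsetUl.
- by rewrite (fsubset_trans _ FG)// fsubsetUr.
Qed.

Lemma expansionZ (x : K) f b : fdom Z f ->
  expansion r psi Z f b -> expansion r psi Z (x *: f) (fun lam e => x * b lam e).
Proof.
move=> fZ fb eps eps0.
have x0 : 0 < modulus x + 1 by rewrite ltr_wpDl ?modulus_ge0.
have [F0 HF] := fb (eps / (modulus x + 1)) (divr_gt0 eps0 x0).
exists F0 => F /HF H; rewrite wsumZ -scalerBr (fnormZ HZ); last first.
  by apply: (fdomB HZ) => //; exact: wsum_dom.
rewrite ltr_pdivlMr// in H; apply: le_lt_trans H.
rewrite mulrC ler_wpM2l// ?lerDl//.
by apply: (fnorm_ge0 HZ); apply: (fdomB HZ) => //; exact: wsum_dom.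
Qed.

Definition unconditional_const (D : R) := 0 <= D /\
  forall F b b',
    (forall lam, lam \in F -> vmod (b lam) <= vmod (b' lam)) ->
    fnorm Z (wsum b F) <= D * fnorm Z (wsum b' F).

Lemma unconditional_constP : unconditional_basis r psi Z ->
  exists D, unconditional_const D.
Proof.
move=> [_ [D HD]]; exists `|D|; split => // F b b' /HD /le_trans; apply.
by rewrite ler_wpM2r ?ler_norm// (fnorm_ge0 HZ)//; exact: wsum_dom.
Qed.

(** A part of the expansion that avoids [G] is also a part of the tail
    [f - wsum b G], and unconditionality bounds parts by the whole. *)
Lemma block_le_tail D f b F G : unconditional_const D -> fdom Z f ->
  expansion r psi Z f b -> [disjoint F & G]%fset ->
  fnorm Z (wsum b F) <= D * fnorm Z (f - wsum b G).
Proof.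
move=> [D0 HD] fZ fb FG.
apply/ler_addgt0Pr => eps eps0.
have D1 : 0 < D + 1 by rewrite ltr_wpDl.
have [F0 HF] := fb (eps / (D + 1)) (divr_gt0 eps0 D1).
set H := (F0 `|` (F `|` G))%fset.
have GH : (G `<=` H)%fset by rewrite /H fsetUA fsubsetUr.
have FH : (F `<=` H `\` G)%fset.
  apply/fsubsetP => lam lF; rewrite in_fsetD !in_fsetU lF (fdisjointP FG _ lF).
  by rewrite orbT.
have := HF H (fsubsetUl _ _); set t := fnorm _ _ => tlt.
have HE : wsum b (H `\` G)%fset = wsum b H - wsum b G.
  rewrite -{2}(fsetID G H) wsumU (fsetIidPr GH); first by rewrite addrC addrA addNr add0r.
  by apply/fdisjointP => lam lG; rewrite in_fsetD lG.
have -> : wsum b F = wsum (coeffs_on b F) (H `\` G)%fset.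
  by rewrite wsum_on (fsetIidPl FH).
have wZ := wsum_dom.
apply: (@le_trans _ _ (D * fnorm Z (wsum b (H `\` G)%fset))).
  by apply: HD => lam _; rewrite /coeffs_on; case: ifP => // _; rewrite vmod0 vmod_ge0.
rewrite HE; apply: (@le_trans _ _ (D * (fnorm Z (f - wsum b G) + t))).
  apply: ler_wpM2l => //.
  have -> : wsum b H - wsum b G = (f - wsum b G) - (f - wsum b H).
    by rewrite opprB [RHS]addrC addrA subrK.
  by apply: (fnormB HZ); exact: (fdomB HZ).
rewrite mulrDr lerD2l; move/ltW : tlt; rewrite ler_pdivlMr// => /(le_trans _); apply.
rewrite mulrC ler_wpM2l ?lerDl//.
by apply: (fnorm_ge0 HZ); exact: (fdomB HZ).
Qed.

Lemma block_le D f b F : unconditional_const D -> fdom Z f ->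
  expansion r psi Z f b -> fnorm Z (wsum b F) <= D * fnorm Z f.
Proof.
move=> HD fZ fb; have := block_le_tail HD fZ fb (fdisjointX0 F).
by rewrite /Defs.wsum big_seq_fset0 subr0.
Qed.

End InSpace.
End Expansions.

(** * Wavelet coefficients in decreasing order *)

Lemma fset_fresh d (F : {fset nabla d}) : exists lam, lam \notin F.
Proof.
exists ((\max_(mu <- enum_fset F) absz mu.1).+1%:Z, 0).
apply/negP => lF; have := @leq_bigmax_seq _ (enum_fset F) xpredT (fun mu => absz mu.1) _ lF isT.
by rewrite /= ltnn.
Qed.

Lemma seq_argmax (R : realType) (T : eqType) (h : T -> R) (s : seq T) x0 :
  x0 \in s -> exists2 x, x \in s & forall y, y \in s -> h y <= h x.
Proof.
elim: s x0 => // a s IH x0 _; case: s IH => [_|b s IH].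
  by exists a; [exact: mem_head|move=> y]; rewrite inE => /eqP ->.
have [x xs Hx] := IH b (mem_head _ _).
have [hax|hxa] := leP (h a) (h x).
  exists x; first by rewrite inE xs orbT.
  move=> y.
  by rewrite in_cons => /predU1P[->//|]; exact: Hx.
exists a; [exact: mem_head|move=> y]; rewrite in_cons => /predU1P[->//|/Hx yx].
exact: le_trans yx (ltW hxa).
Qed.

Section BasisTheory.
Variables (R : realType) (d : nat) (c : scalars) (r : R) (E : finType).
Variables (psi : E -> distr R d c) (Z : fspace R d c).
Hypothesis HZ : function_space r Z.
Hypothesis UZ : unconditional_basis r psi Z.
Local Notation K := (Defs.scalar R c).
Local Notation coeffs := (nabla d -> E -> K).
Implicit Types (b : coeffs) (F G : {fset nabla d}) (lam mu : nabla d).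
Local Notation wsum := (wsum r psi).
Local Notation wterm := (wterm r psi).

Lemma place00 f : place r 0 0 f = f :> distr R d c.
Proof.
apply/funext => theta; rewrite placeE mulr0 powRr0 expr0z expr1n invr1.
by rewrite of_real1 !mul1r; congr f; apply/funext => x; rewrite scale1r addr0.
Qed.

Lemma atom_dom e lam : fdom Z (rescale r (psi e) lam).
Proof. by case: UZ => -[]. Qed.

Lemma psi_dom e : fdom Z (psi e).
Proof.
have := atom_dom e (0, 0); rewrite rescaleE/= (_ : intvec R 0 = 0) ?place00//.
by apply/rowP => i; rewrite !mxE.
Qed.

(** Otherwise 0 would have two expansions. *)
Lemma psi_norm_gt0 e : 0 < fnorm Z (psi e).
Proof.
rewrite lt_neqAle (fnorm_ge0 HZ) ?andbT; last exact: psi_dom.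
apply/negP => /eqP n0.
have [_ /(_ 0 (fdom0 HZ))[b [_ buniq]]] := UZ.1.
pose b1 : coeffs := fun lam e' => (e' == e)%:R.
have wt0 b' lam : (forall lam e', e' != e -> b' lam e' = 0) -> fnorm Z (wterm b' lam) = 0.
  move=> b'0; rewrite /Defs.wterm (bigD1 e)//= big1 => [|i ie].
    rewrite addr0 (fnormZ HZ); last exact: atom_dom.
    by rewrite (rescale_norm HZ) -?n0 ?mulr0//; exact: psi_dom.
  by rewrite b'0// scale0r.
have exp0 b' : (forall lam e', e' != e -> b' lam e' = 0) -> expansion r psi Z 0 b'.
  move=> b'0 eps eps0; exists fset0 => F _.
  have wZ := wsum_dom HZ atom_dom; rewrite sub0r (fnormN HZ)//.
  apply: le_lt_trans eps0; rewrite /Defs.wsum.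
  apply: (le_trans (fnorm_sum HZ _ _)) => [lam _|]; first exact: (wterm_dom HZ atom_dom).
  by rewrite big1// => lam _; exact: wt0.
have := buniq (fun _ _ => 0) (exp0 _ (fun _ _ _ => erefl)).
rewrite (buniq b1) => [/(congr1 (fun b' => b' (0, 0) e))|]; last first.
  by apply: exp0 => lam e' /negbTE; rewrite /b1 => ->.
by move/eqP; rewrite /b1 eqxx oner_eq0.
Qed.

Lemma wterm_norm_le b lam :
  fnorm Z (wterm b lam) <= \sum_(e : E) modulus (b lam e) * fnorm Z (psi e).
Proof.
apply: (le_trans (fnorm_sum HZ _ _)) => [e _|].
  by apply: (fdomZ HZ); exact: atom_dom.
apply: ler_sum => e _; rewrite (fnormZ HZ); last exact: atom_dom.
by rewrite (rescale_norm HZ)//; exact: psi_dom.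
Qed.

(** A coefficient vector may be rotated onto one generator without changing
    its modulus, at the cost of the unconditionality constant. *)
Lemma vmod_le_wterm : exists2 B, 0 <= B & forall b lam,
  vmod (b lam) <= B * fnorm Z (wterm b lam).
Proof.
have [D [D0 HD]] := unconditional_constP HZ atom_dom UZ.
have [e0|noE] := pickP (fun _ : E => true); last first.
  by exists 0 => // b lam; rewrite /vmod big_pred0// sqrtr0 mul0r.
move=> _; exists (D / fnorm Z (psi e0)).
  by rewrite divr_ge0// ltW// psi_norm_gt0.
move=> b lam; rewrite mulrAC ler_pdivlMr ?psi_norm_gt0//.
have := HD [fset lam]%fset (single c e0 (fun mu => vmod (b mu))) b; rewrite !wsum_fset1.
rewrite wterm_single (fnormZ HZ) ?modulus_of_real ?(rescale_norm HZ); last 2 first.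
- exact: psi_dom.
- exact: atom_dom.
by rewrite ger0_norm ?vmod_ge0//; apply => mu _; rewrite vmod_single ger0_norm ?vmod_ge0.
Qed.

Lemma coef_bounded : exists2 B, 0 <= B & forall f b, fdom Z f ->
  expansion r psi Z f b -> forall lam, vmod (b lam) <= B * fnorm Z f.
Proof.
have [D HD] := unconditional_constP HZ atom_dom UZ.
have [B B0 HB] := vmod_le_wterm.
exists (B * D) => [|f b fZ fb lam]; first by rewrite mulr_ge0// HD.1.
apply: (le_trans (HB _ _)); rewrite -mulrA ler_wpM2l// -wsum_fset1.
exact: (block_le HZ atom_dom _ HD).
Qed.

Lemma coef_decay f b : fdom Z f -> expansion r psi Z f b ->
  forall eps, 0 < eps -> exists F, forall lam, lam \notin F -> vmod (b lam) < eps.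
Proof.
move=> fZ fb eps eps0; have [B B0 HB] := vmod_le_wterm.
have B1 : 0 < 2 * (B + 1) by rewrite mulr_gt0// ltr_wpDl.
have [F HF] := fb _ (divr_gt0 eps0 B1); exists F => lam lF.
have := HF _ (fsubsetUl F [fset lam]%fset); have := HF F (fsubset_refl F).
have -> : wsum b (F `|` [fset lam])%fset = wsum b F + wterm b lam.
  by rewrite wsumU ?wsum_fset1// fdisjointX1.
set x := fnorm _ _ => xlt; set y := fnorm _ _ => ylt.
have wZ := wsum_dom HZ atom_dom; have tZ := wterm_dom HZ atom_dom.
have txy : fnorm Z (wterm b lam) <= x + y.
  have -> : wterm b lam = (f - wsum b F) - (f - (wsum b F + wterm b lam)).
    by rewrite opprB addrC addrA subrK addrAC subrr add0r.
  by apply: (fnormB HZ); apply: (fdomB HZ) => //; exact: (fdomD HZ).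
apply: (le_lt_trans (HB _ _)).
apply: (@le_lt_trans _ _ ((B + 1) * (x + y))).
  have t0 := fnorm_ge0 HZ (tZ b lam).
  by apply: ler_pM => //; rewrite lerDl.
have : x + y < eps / (2 * (B + 1)) + eps / (2 * (B + 1)) by exact: ltrD.
have B1' : 0 < B + 1 by rewrite ltr_wpDl.
rewrite -(ltr_pM2l B1') => /lt_le_trans; apply.
by rewrite le_eqVlt; apply/orP; left; apply/eqP; field; rewrite gt_eqF.
Qed.

(** An enumeration by decreasing modulus. Indices with a zero coefficient need
    not occur in it. *)
Definition greedy b (nu : nat -> nabla d) := injective nu /\
  forall m mu, (forall i, (i < m)%N -> nu i <> mu) -> vmod (b mu) <= vmod (b (nu m)).

(** The supremum of [vmod (b mu)] over [mu] outside [F] is attained because only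
    finitely many coefficients exceed a given positive level. *)
Lemma greedy_step f b : fdom Z f -> expansion r psi Z f b ->
  forall F, exists lam, lam \notin F /\
    forall mu, mu \notin F -> vmod (b mu) <= vmod (b lam).
Proof.
move=> fZ fb F; have [lam0 l0F] := fset_fresh F.
have [allz|] := pselect (forall mu, mu \notin F -> vmod (b mu) <= vmod (b lam0)).
  by exists lam0.
move=> /existsNP[mu1 /not_implyP[m1F /negP]]; rewrite -ltNge => lt1.
have p1 : 0 < vmod (b mu1) by rewrite (le_lt_trans _ lt1)// vmod_ge0.
have [G HG] := coef_decay fZ fb p1.
pose s := [seq mu <- enum_fset (mu1 |` G)%fset | mu \notin F].
have m1s : mu1 \in s by rewrite mem_filter m1F/= in_fset1U eqxx.
have [x xs Hx] := seq_argmax (fun mu => vmod (b mu)) m1s.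
exists x; split; first by move: xs; rewrite mem_filter => /andP[].
move=> mu mF; have [mG|mG] := boolP (mu \in G).
  by apply: Hx; rewrite mem_filter mF/= in_fset1U mG orbT.
exact: le_trans (ltW (HG _ mG)) (Hx _ m1s).
Qed.

Lemma greedy_exists f b : fdom Z f -> expansion r psi Z f b ->
  exists nu : nat -> nabla d, greedy b nu.
Proof.
move=> fZ fb; have /choice[g Hg] := greedy_step fZ fb.
pose S := fix S n := if n is n'.+1 then (g (S n') |` S n')%fset else fset0.
have inS i m : (i < m)%N -> g (S i) \in S m.
  elim: m => // m IH; rewrite ltnS leq_eqVlt => /predU1P[->|/IH im] /=.
    by rewrite in_fset1U eqxx.
  by rewrite in_fset1U im orbT.
have Sin m mu : mu \in S m -> exists2 i, (i < m)%N & g (S i) = mu.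
  elim: m => [|m IH] /=; first by rewrite in_fset0.
  rewrite in_fset1U => /predU1P[->|/IH[i im <-]]; first by exists m.
  by exists i => //; exact: ltnW.
exists (fun n => g (S n)); split.
  suff W i j : (i < j)%N -> g (S i) != g (S j).
    move=> i j /eqP; have [/W/negbTE ->|/W/negbTE|->]//= := ltngtP i j.
    by rewrite eq_sym => ->.
  move=> ij; apply: contraNneq (Hg (S j)).1 => <-; exact: inS.
move=> m mu Hmu; apply: (Hg _).2; apply/negP => /Sin[i im]; exact: Hmu.
Qed.

End BasisTheory.

(** * The error of greedy partial sums *)

Lemma cvge0_lt (R : realType) (x : nat -> \bar R) : x @ \oo --> (0 : \bar R) ->
  forall eps : R, 0 < eps -> exists N : nat, forall n, (N <= n)%N -> (x n < eps%:E)%E.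
Proof.
move=> x0 eps eps0.
have [|N _ HN] := x0 [set y | (y < eps%:E)%E]; last by exists N => n /HN.
rewrite /= -[nbhs _ _]/(nbhs (0 : R) (fun y => (y%:E < eps%:E)%E)).
by near=> y; rewrite lte_fin; near: y; exact: lt_nbhsl.
Unshelve. all: by end_near. Qed.

Section Initial.
Variables (R : realType) (d : nat) (c : scalars) (r : R) (E : finType).
Variable psi : E -> distr R d c.
Local Notation K := (Defs.scalar R c).
Local Notation coeffs := (nabla d -> E -> K).
Implicit Types (b : coeffs) (F G : {fset nabla d}) (lam mu : nabla d).
Implicit Types (nu : nat -> nabla d) (P : pred nat).
Local Notation wsum := (wsum r psi).
Local Notation wterm := (wterm r psi).

Definition initial nu M P : {fset nabla d} :=
  seq_fset tt [seq nu m | m <- iota 0 M & P m].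

Lemma initialP nu M P lam :
  reflect (exists m, [/\ (m < M)%N, P m & lam = nu m]) (lam \in initial nu M P).
Proof.
rewrite /initial seq_fsetE; apply: (iffP mapP) => [[m]|[m [mM Pm ->]]].
  by rewrite mem_filter mem_iota/= add0n => /andP[Pm mM] ->; exists m.
by exists m => //; rewrite mem_filter mem_iota Pm.
Qed.

Lemma wsum_initial b nu M P : injective nu ->
  wsum b (initial nu M P) = \sum_(0 <= m < M | P m) wterm b (nu m).
Proof.
move=> inj; rewrite (@wsum_seq _ _ _ _ _ _ _ _ [seq nu m | m <- iota 0 M & P m]).
- by rewrite big_map big_filter /index_iota subn0.
- by rewrite map_inj_uniq// filter_uniq// iota_uniq.
- by move=> lam; rewrite seq_fsetE.
Qed.

Lemma initial_disjoint nu M N P P' : injective nu ->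
  (forall m, (m < M)%N -> (m < N)%N -> P m -> ~~ P' m) ->
  [disjoint initial nu M P & initial nu N P']%fset.
Proof.
move=> inj PP'; apply/fdisjointP => lam /initialP[m [mM Pm ->]].
apply/negP => /initialP[m' [mN Pm' /inj mm']]; subst m'.
by have /negP := PP' _ mM mN Pm.
Qed.

Lemma card_initial nu M : injective nu -> #|` initial nu M xpredT| = M.
Proof.
move=> inj; rewrite /initial size_seq_fset undup_id ?filter_predT ?size_map ?size_iota//.
by rewrite map_inj_uniq// iota_uniq.
Qed.

End Initial.

Section GreedyError.
Variables (R : realType) (d : nat) (c : scalars) (r : R) (E : finType).
Variables (psi : E -> distr R d c) (X Y : fspace R d c).
Hypothesis HX : function_space r X.
Hypothesis HY : function_space r Y.
Hypothesis UX : unconditional_basis r psi X.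
Hypothesis XY : embedded X Y.
Local Notation K := (Defs.scalar R c).
Local Notation coeffs := (nabla d -> E -> K).
Local Notation wsum := (wsum r psi).
Local Notation wterm := (wterm r psi).

Lemma embedded_const : exists2 A : R, 0 < A &
  forall f, fdom X f -> fnorm Y f <= A * fnorm X f.
Proof.
have [_ [A HA]] := XY; exists (`|A| + 1); first by rewrite ltr_wpDl.
move=> f fX; apply: (le_trans (HA _ fX)); rewrite ler_wpM2r ?(fnorm_ge0 HX)//.
by rewrite (le_trans (ler_norm A))// lerDl.
Qed.

Lemma embedded_expansion f b : fdom X f ->
  expansion r psi X f b -> expansion r psi Y f b.
Proof.
move=> fX fb eps eps0; have [A A0 HA] := embedded_const.
have [F0 HF] := fb _ (divr_gt0 eps0 A0); exists F0 => F /HF.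
rewrite ltr_pdivlMr// mulrC; apply: le_lt_trans; apply: HA.
by apply: (fdomB HX) => //; exact: (wsum_dom HX (atom_dom UX)).
Qed.

(** The nonlinear projector is only specified up to ties. Doubling the
    coefficients on the chosen set [G] makes [G] the set of largest ones, so the
    projection error of the modified function is exactly [f - wsum b G]. *)
Lemma greedy_error (Q : nat -> distr R d c -> distr R d c) :
  nonlinear_projector r psi X Q -> assumption1 X Y Q ->
  forall B eps, 0 < eps -> exists M0, forall M f b nu, (M0 <= M)%N ->
    fdom X f -> fnorm X f <= B -> expansion r psi X f b -> greedy b nu ->
    fnorm Y (f - \sum_(0 <= m < M) wterm b (nu m)) <= eps.
Proof.
move=> HQ A1 B0 eps eps0.
have pX := atom_dom UX.
have [D HD] := unconditional_constP HX pX UX.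
wlog B00 : B0 / 0 <= B0.
  move=> W; have [M0 HM] := W `|B0| (normr_ge0 _).
  exists M0 => M f b nu MM fX fB; apply: HM => //.
  exact: le_trans fB (ler_norm _).
pose B : R := (1 + D) * B0 + 1.
have B1 : 0 < B by rewrite ltr_wpDl// mulr_ge0// addr_ge0// HD.1.
have [M0 HM] := cvge0_lt A1 (divr_gt0 eps0 B1).
exists M0 => M f b nu MM fX fB fb [inj nug].
set G := initial nu M xpredT.
have GE : \sum_(0 <= m < M) wterm b (nu m) = wsum b G by rewrite wsum_initial.
rewrite GE.
pose f' : distr R d c := f + wsum b G; pose b' : coeffs := b + coeffs_on b G.
have gX : fdom X (wsum b G) by exact: (wsum_dom HX pX).
have f'X : fdom X f' by exact: (fdomD HX).
have f'b' : expansion r psi X f' b'.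
  by apply: expansionD => //; exact: expansion_wsum.
have f'B : fnorm X f' <= B.
  apply: (le_trans (fnormD HX fX gX)).
  have := block_le HX pX G HD fX fb.
  rewrite /B mulrDl mul1r => /le_trans/(_ (ler_wpM2l HD.1 fB)) gB.
  by rewrite -addrA lerD// (le_trans gB)// lerDl.
pose x : K := of_real c B^-1.
have mx : modulus x = B^-1 by rewrite modulus_of_real ger0_norm// invr_ge0 ltW.
have xX : fdom X (x *: f') by exact: (fdomZ HX).
have xN : fnorm X (x *: f') <= 1 by rewrite (fnormZ HX)// mx mulrC ler_pdivrMr// mul1r.
have xb := expansionZ HX pX x f'X f'b'.
have [EM [cEM HEM QE]] := HQ M _ xX _ xb.
have b'G lam : lam \in G -> vmod (b' lam) = 2 * vmod (b lam).
  move=> lG; rewrite (_ : b' lam = fun e => of_real c 2 * b lam e).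
    by rewrite vmodZ modulus_of_real ger0_norm.
  apply/funext => e; have -> : b' lam e = (b lam e : K) *+ 2.
    by rewrite /b' [LHS]/(b lam e + coeffs_on b G lam e) /coeffs_on lG mulr2n.
  have -> : of_real c (2 : R) = 2 by case: (c) => //=; apply/eqP; rewrite eq_complex/= addr0 !eqxx.
  by rewrite mulr_natl.
have b'nG lam : lam \notin G -> b' lam = b lam.
  move=> /negbTE lG; apply/funext => e.
  have -> : b' lam e = b lam e + coeffs_on b G lam e by [].
  by rewrite /coeffs_on lG; exact: addr0.
(* An exchange between [G] and [EM] can only involve zero coefficients, since
   those of [G] have been doubled. *)
have cross lam mu : lam \in G -> lam \notin EM -> mu \in EM -> mu \notin G ->
    vmod (b lam) = 0 /\ vmod (b mu) = 0.
  move=> lG lE mE mG; have := HEM _ _ mE lE; rewrite !vmodZ mx.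
  rewrite ler_pM2l ?invr_gt0// b'G// b'nG// => le2.
  have le1 : vmod (b mu) <= vmod (b lam).
    move/initialP : lG => [m [mM _ ->]]; apply: nug => i im numu.
    by move/negP : mG; apply; apply/initialP; exists i; split => //; exact: ltn_trans mM.
  have [v0 w0] := (vmod_ge0 (b lam), vmod_ge0 (b mu)); lra.
have card_eq : #|` EM `\` G|%fset = #|` G `\` EM|%fset.
  have := cardfsID G EM; have := cardfsID EM G.
  by rewrite cEM card_initial// fsetIC => <- /addnI.
have zero lam : (lam \in EM) != (lam \in G) -> b lam = 0.
  case: (boolP (lam \in EM)) => lE; case: (boolP (lam \in G)) => lG // _.
    have : (0 < #|` (G `\` EM)%fset|)%N.
      by rewrite -card_eq cardfs_gt0; apply/fset0Pn; exists lam; rewrite in_fsetD lE lG.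
    rewrite cardfs_gt0 => /fset0Pn[mu]; rewrite in_fsetD => /andP[mE mG].
    by have [_ /vmod_eq0] := cross _ _ mG mE lE lG.
  have : (0 < #|` (EM `\` G)%fset|)%N.
    by rewrite card_eq cardfs_gt0; apply/fset0Pn; exists lam; rewrite in_fsetD lE lG.
  rewrite cardfs_gt0 => /fset0Pn[mu]; rewrite in_fsetD => /andP[mG mE].
  by have [/vmod_eq0] := cross _ _ lG lE mE mG.
have wE : wsum b' EM = wsum b G + wsum b G.
  have -> : wsum b' EM = wsum b' G.
    rewrite -(eq_wsum r psi (b := coeffs_on b' G)) => [|lam lE].
      rewrite wsum_on fsetIC -wsum_on; apply: eq_wsum => lam lG.
      rewrite /coeffs_on; case: ifPn => // lE; apply/esym/vmod_eq0.
      by rewrite b'G// zero ?lG ?(negbTE lE)// vmod0 mulr0.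
    by rewrite /coeffs_on; case: ifPn => // lG; rewrite b'nG// zero// lE (negbTE lG).
  by rewrite wsumD wsum_on fsetIid.
have YX : fdom X `<=` fdom Y by case: XY.
have := HM M MM; move=> supM; have : ((fnorm Y (x *: f' - Q M (x *: f')))%:E < (eps / B)%:E)%E.
  by apply: le_lt_trans supM; apply: ereal_sup_ubound; exists (x *: f').
rewrite QE wsumZ -scalerBr wE /f' opprD addrACA subrr addr0 lte_fin.
rewrite (fnormZ HY) ?mx => [|]; last by apply: YX; exact: (fdomB HX).
by rewrite ltr_pdivlMr// mulrAC mulVf ?gt_eqF// mul1r => /ltW.
Qed.

End GreedyError.

(** * Extraction of subsequences *)

Notation increasing s := {homo s : m n / (m < n)%N}.

Lemma increasing_ge (s : nat -> nat) : increasing s -> forall n, (n <= s n)%N.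
Proof.
by move=> si; elim=> // n IH; apply: (leq_ltn_trans IH); exact: si.
Qed.

Lemma increasing_comp (s t : nat -> nat) :
  increasing s -> increasing t -> increasing (s \o t).
Proof. by move=> si ti m n mn; apply: si; exact: ti. Qed.

Lemma increasing_step (s : nat -> nat) : (forall n, (s n < s n.+1)%N) -> increasing s.
Proof.
move=> st m n; elim: n => // n IH; rewrite ltnS leq_eqVlt => /predU1P[->//|/IH].
by move/ltn_trans; apply.
Qed.

(** Diagonal extraction. [P q] is a property of extractions that only concerns
    the behaviour at infinity: it passes to everything that is eventually a
    further extraction. *)
Lemma diagonal_extraction (T : countType) (P : T -> (nat -> nat) -> Prop) :
  (forall q s, increasing s -> exists2 t, increasing t & P q (s \o t)) ->
  (forall q s s', P q s -> (exists N (rho : nat -> nat), (forall n, (n <= rho n)%N) /\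
     forall n, (N <= n)%N -> s' n = s (rho n)) -> P q s') ->
  exists2 s, increasing s & forall q, P q s.
Proof.
move=> H1 H2; pose P' n s := if @choice.unpickle T n is Some q then P q s else True.
have H1' n s : increasing s -> exists t, increasing t /\ P' n (s \o t).
  rewrite /P'; case: (@choice.unpickle T n) => [q|] si; last by exists id; split => // m n.
  by have [t ti Pt] := H1 q s si; exists t.
have /choice[g Hg] : forall ns : nat * (nat -> nat), exists t,
    increasing ns.2 -> increasing t /\ P' ns.1 (ns.2 \o t).
  move=> [n s] /=; have [/(H1' n)[t Ht]|ns] := pselect (increasing s).
    by exists t.
  by exists id.
pose S := fix S n := if n is n'.+1 then S n' \o g (n', S n') else id.
have Si n : increasing (S n).
  by elim: n => //= n IH; apply: increasing_comp => //; exact: (Hg (n, S n) IH).1.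
have gi n : increasing (g (n, S n)) by exact: (Hg (n, S n) (Si n)).1.
have SP n : P' n (S n.+1) by exact: (Hg (n, S n) (Si n)).2.
exists (fun n => S n n).
  by apply: increasing_step => n /=; apply: Si; exact: increasing_ge.
move=> q; have := SP (choice.pickle q); rewrite /P' choice.pickleK => /H2; apply.
set N := (choice.pickle q).+1; exists N.
(* From rank [N] on, the diagonal is an extraction from [S N]. *)
have tail k : exists rho : nat -> nat, (forall n, (n <= rho n)%N) /\
    forall n, S (N + k)%N n = S N (rho n).
  elim: k => [|k [rho [rge IH]]]; first by exists id; rewrite addn0.
  exists (rho \o g ((N + k)%N, S (N + k)%N)); split => n.
    by rewrite (leq_trans _ (rge _))// increasing_ge.
  by rewrite addnS; exact: IH.
have /choice[rho Hrho] := tail.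
exists (fun n => rho (n - N)%N n); split => n; first by have [] := Hrho (n - N)%N.
by move=> Nn; have [_] := Hrho (n - N)%N; rewrite subnKC.
Qed.

Lemma frequently_subseq (P : nat -> Prop) :
  (forall N, exists2 n, (N <= n)%N & P n) -> exists2 s, increasing s & forall n, P (s n).
Proof.
move=> H; have /choice[g Hg] : forall N, exists n, (N <= n)%N /\ P n.
  by move=> N; have [n] := H N; exists n.
pose s := fix s n := if n is n'.+1 then g (s n').+1 else g 0.
exists s; last by case=> [|n]; exact: (Hg _).2.
by apply: increasing_step => n; exact: (Hg _).1.
Qed.

Lemma pigeonhole_subseq (T : finType) (x : nat -> T) :
  exists2 s, increasing s & exists v, forall n, x (s n) = v.
Proof.
suff [v Hv] : exists v, forall N, exists2 n, (N <= n)%N & x n = v.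
  by have [s si sv] := frequently_subseq Hv; exists s => //; exists v.
apply: contrapT => /forallNP H.
have /choice[N HN] : forall v, exists N, forall n, (N <= n)%N -> x n <> v.
  move=> v; have /existsNP[N HN] := H v; exists N => n Nn xv.
  by apply: HN; exists n.
pose M := \max_v N v; have := HN (x M) M; rewrite leq_bigmax => /(_ isT).
exact.
Qed.

Section RealSubsequences.
Variable R : realType.
Implicit Types x : nat -> R.

Lemma cvgn_pinftyP x :
  x @ \oo --> +oo <-> forall A, exists N : nat, forall n, (N <= n)%N -> A <= x n.
Proof.
split=> [/cvgryPge H A|H]; first by have [N _ HN] := H A; exists N => n /HN.
by apply/cvgryPge => A; have [N HN] := H A; exists N.
Qed.

Lemma pinfty_or_bounded x : x @ \oo --> +oo \/
  exists A, forall N, exists2 n, (N <= n)%N & x n <= A.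
Proof.
have [xoo|noo] := pselect (x @ \oo --> +oo); [by left|right].
apply: contrapT => /forallNP H; apply: noo; apply/cvgn_pinftyP => A.
have /existsNP[N HN] := H A; exists N => n Nn; rewrite leNgt; apply/negP => /ltW xA.
by apply: HN; exists n.
Qed.

Lemma bolzano_weierstrass x B : (forall n, `|x n| <= B) ->
  exists2 s, increasing s & exists l : R, x (s n) @[n --> \oo] --> l.
Proof.
move=> xB; have xI : (x @ \oo) `[- B, B]%classic.
  by exists 0 => // n _ /=; rewrite in_itv/= -ler_norml.
have [l [_ lx]] := @segment_compact R (- B) B (x @ \oo) _ xI.
have [s si sl] := (cluster_eventually_cvg x l).1 lx; exists s; last by exists l.
by move=> m n mn; have := si n m; rewrite !leEnat [(n <= m)%N]leqNgt mn => /negbT; rewrite -ltnNge.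
Qed.

Lemma cvgnP x (l : R) : x @ \oo --> l <->
  forall eps, 0 < eps -> exists N : nat, forall n, (N <= n)%N -> `|x n - l| <= eps.
Proof.
split=> [/cvgrPdist_le H eps e0|H].
  by have [N _ HN] := H _ e0; exists N => n /HN /=; rewrite distrC.
apply/cvgrPdist_le => eps e0; have [N HN] := H _ e0.
by exists N => // n /= /HN; rewrite distrC.
Qed.

Lemma modulus_subseq (c : scalars) (z : nat -> Defs.scalar R c) B :
  (forall n, modulus (z n) <= B) ->
  exists2 s, increasing s & exists l, (fun n => modulus (z (s n) - l)) @ \oo --> (0 : R).
Proof.
case: c z => z zB.
  have [s si [l /cvgnP sl]] := bolzano_weierstrass zB.
  exists s => //; exists l; apply/cvgnP => eps /sl[N HN]; exists N => n /HN.
  by rewrite subr0 normr_id.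
have [ReB ImB] : (forall n, `|complex.Re (z n)| <= B) /\ (forall n, `|complex.Im (z n)| <= B).
  split=> n; apply: le_trans (zB n); rewrite /= -sqrtr_sqr ler_wsqrtr//.
    by rewrite lerDl sqr_ge0.
  by rewrite lerDr sqr_ge0.
have [s si [l /cvgnP sl]] := bolzano_weierstrass ReB.
have [t ti [k /cvgnP tk]] := bolzano_weierstrass (fun n => ImB (s n)).
exists (s \o t); first exact: increasing_comp.
exists (Complex l k); apply/cvgnP => eps e0.
have e20 : 0 < eps / 2 by rewrite divr_gt0.
have [N HN] := sl _ e20; have [M HM] := tk _ e20.
exists (maxn N M) => n; rewrite geq_max => /andP[Nn Mn].
have := HN (t n) (leq_trans Nn (increasing_ge ti n)); have := HM n Mn.
move=> yk xl; rewrite subr0 ger0_norm ?modulus_ge0//= /comp.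
case: (z (s (t n))) yk xl => x y /= yk xl.
apply: (@le_trans _ _ (`|x - l| + `|y - k|)); last by rewrite (splitr eps); exact: lerD.
set v := y - k; set u := x - l.
rewrite -(ler_pXn2r (n := 2)) ?nnegrE ?sqrtr_ge0 ?addr_ge0//.
rewrite sqr_sqrtr ?addr_ge0 ?sqr_ge0// [leRHS]sqrrD -!normrX !(ger0_norm (sqr_ge0 _)).
by rewrite addrAC lerDl mulrn_wge0// mulr_ge0.
Qed.

End RealSubsequences.

(** * Relative positions of scale-space indices *)

Section Indices.
Variables (R : realType) (d : nat).
Implicit Types (lam mu : nat -> nabla d) (y z : 'rV[R]_d).

Definition shift lam mu (n : nat) : 'rV[R]_d :=
  intvec R (lam n).2 - 2 ^ ((lam n).1 - (mu n).1) *: intvec R (mu n).2.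

(** The alternative to orthogonality: the relative position is eventually
    constant. Its space part [y] is a real vector, because [2 ^ delta *: k] has
    fractional entries when [delta < 0]. *)
Definition merged lam mu := exists delta y N, forall n, (N <= n)%N ->
  (lam n).1 - (mu n).1 = delta /\ shift lam mu n = y.

Lemma merged_sym lam mu : merged lam mu -> merged mu lam.
Proof.
move=> [delta [y [N H]]]; exists (- delta), (- (2 ^ (- delta) *: y)), N => n Nn.
have [<- <-] := H n Nn; split; first by rewrite opprB.
rewrite /shift -(opprB (lam n).1 (mu n).1); set D := _ - _.
by rewrite scalerBr opprB scalerA -expfzDr ?pnatr_eq0// addNr expr0z scale1r.
Qed.

Lemma merged_refl lam : merged lam lam.
Proof.
exists 0, 0, 0%N => n _; rewrite /shift subrr; split=> //.
by rewrite expr0z scale1r subrr.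
Qed.

Lemma merged_trans mu lam eta : merged lam mu -> merged mu eta -> merged lam eta.
Proof.
move=> [j1 [y1 [N1 H1]]] [j2 [y2 [N2 H2]]].
exists (j1 + j2), (y1 + 2 ^ j1 *: y2), (maxn N1 N2) => n.
rewrite geq_max => /andP[/H1[<- <-] /H2[<- <-]]; rewrite addrA subrK; split=> //.
rewrite /shift scalerBr scalerA -expfzDr ?pnatr_eq0// [_ - _ + (_ - _)]addrA subrK.
by rewrite addrA subrK.
Qed.

Lemma norm_le_enorm z i : `|z 0 i| <= enorm z.
Proof.
rewrite /enorm -sqrtr_sqr ler_wsqrtr// (bigD1 i)//= lerDl.
by rewrite sumr_ge0// => j _; rewrite sqr_ge0.
Qed.

Lemma bounded_int_code (A : R) : exists (T : finType) (g : T -> int),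
  forall m : int, `|m%:~R| <= A -> exists t, m = g t.
Proof.
pose N := absz (Num.floor A).
exists 'I_(N.*2.+1), (fun t : 'I_(N.*2.+1) => (nat_of_ord t)%:Z - N%:Z) => m mA.
have mN : (absz m <= N)%N.
  have : `|m| <= Num.floor A by rewrite floor_ge_int intr_norm.
  by rewrite /N; lia.
have tN : (absz (m + N%:Z)%R < N.*2.+1)%N by lia.
by exists (Ordinal tN) => /=; lia.
Qed.

(** A real sequence either tends to infinity or is bounded along a subsequence.
    Once the scale difference is a constant [delta], the space differences lie in
    the lattice of mesh [2 ^ - |delta|], whose bounded subsets are finite. *)
Lemma orthogonal_or_merged lam mu : exists2 s, increasing s &
  orthogonal_indices R (lam \o s) (mu \o s) \/ merged (lam \o s) (mu \o s).
Proof.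
have [joo|[A /frequently_subseq[s1 s1i jA]]] :=
  pinfty_or_bounded (fun n => `|(lam n).1%:~R - (mu n).1%:~R| : R).
  by exists id => //; do 2 left.
have [T [g Hg]] := bounded_int_code A.
have /choice[h Hh] : forall n, exists t : T, (lam (s1 n)).1 - (mu (s1 n)).1 = g t.
  by move=> n; apply: Hg; rewrite intrB.
have [s2 s2i [t Ht]] := pigeonhole_subseq h.
pose delta := g t; pose s := s1 \o s2.
have si : increasing s by exact: increasing_comp.
have jd n : (lam (s n)).1 - (mu (s n)).1 = delta by rewrite /s/= Hh Ht.
have [koo|[B /frequently_subseq[s3 s3i kB]]] :=
  pinfty_or_bounded (fun n => enorm (shift (lam \o s) (mu \o s) n)).
  by exists s => //; left; right.
have [T' [g' Hg']] := bounded_int_code (2 ^+ absz delta * B).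
pose code (v : {ffun 'I_d -> T'}) : 'rV[R]_d := \row_i (2 ^- absz delta * (g' (v i))%:~R).
have /choice[h' Hh'] : forall n, exists v, shift (lam \o s) (mu \o s) (s3 n) = code v.
  move=> n; pose z := shift (lam \o s) (mu \o s) (s3 n).
  have zint i : exists m : int, 2 ^+ absz delta * z 0 i = m%:~R.
    apply/intrP; rewrite /z /shift /= jd !mxE mulrBr mulrA.
    have dint : (2 : R) ^+ absz delta * 2 ^ delta \is a Num.int.
      case: (delta) => k; first by rewrite -exprnP rpredM ?rpredX// intr_nat.
      by rewrite NegzE -exprnN abszN absz_nat mulfV ?rpred1// expf_neq0// pnatr_eq0.
    apply: rpredB; (apply: rpredM; last exact: intr_int); last exact: dint.
    by apply: rpredX; exact: intr_nat.
  have /choice[v Hv] : forall i, exists t : T', 2 ^+ absz delta * z 0 i = (g' t)%:~R.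
    move=> i; have [m Hm] := zint i; have [|t' mt] := Hg' m; last first.
      by exists t'; rewrite Hm mt.
    rewrite -Hm normrM ger0_norm ?exprn_ge0// ler_pM2l ?exprn_gt0//.
    exact: le_trans (norm_le_enorm _ _) (kB n).
  exists [ffun i => v i]; apply/rowP => i; rewrite -/z [RHS]mxE ffunE -Hv mulKf//.
have [s4 s4i [v Hv]] := pigeonhole_subseq h'.
exists (s \o (s3 \o s4)); first by apply: increasing_comp => //; exact: increasing_comp.
right; exists delta, (code v), 0%N => n _ /=; split; first exact: jd.
by rewrite -(Hv n) -Hh'.
Qed.

Definition restriction (s s' : nat -> nat) := exists N (rho : nat -> nat),
  (forall n, (n <= rho n)%N) /\ forall n, (N <= n)%N -> s' n = s (rho n).

Lemma orthogonal_or_merged_restriction lam mu s s' : restriction s s' ->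
  orthogonal_indices R (lam \o s) (mu \o s) \/ merged (lam \o s) (mu \o s) ->
  orthogonal_indices R (lam \o s') (mu \o s') \/ merged (lam \o s') (mu \o s').
Proof.
move=> [N [rho [rge sE]]].
have oo (x x' : nat -> R) : (forall n, (N <= n)%N -> x' n = x (rho n)) ->
    x @ \oo --> +oo -> x' @ \oo --> +oo.
  move=> xx' /cvgn_pinftyP H; apply/cvgn_pinftyP => A; have [M HM] := H A.
  exists (maxn N M) => n; rewrite geq_max => /andP[Nn Mn].
  by rewrite xx'//; apply: HM; exact: leq_trans (rge n).
case=> [[joo|koo]|[delta [y [M HM]]]].
- by left; left; apply: oo joo => n Nn /=; rewrite sE.
- by left; right; apply: oo koo => n Nn /=; rewrite sE.
- right; exists delta, y, (maxn N M) => n; rewrite geq_max => /andP[Nn Mn].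
  by rewrite /shift/= sE//; apply: (HM (rho n)); exact: leq_trans (rge n).
Qed.

End Indices.

(** * The reverse Minkowski inequality *)

Section SuperadditiveFunctionals.
Variable R : realType.

Lemma sum_powR_ge1 (N : nat) (x : nat -> R) (theta : R) : 1 <= theta ->
  (forall i, 0 <= x i) ->
  \sum_(i < N) x i `^ theta <= (\sum_(i < N) x i) `^ theta.
Proof.
move=> t1 x0; have t0 : 0 < theta by exact: lt_le_trans t1.
set X := \sum_(i < N) x i; have X0 : 0 <= X by apply: sumr_ge0.
rewrite -(mulr_powRB1 X0 t0) {1}/X mulr_suml; apply: ler_sum => i _.
rewrite -(mulr_powRB1 (x0 i) t0) ler_wpM2l// ge0_ler_powR ?subr_ge0 ?nnegrE//.
by rewrite /X (bigD1 i)//= lerDl sumr_ge0.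
Qed.

(** Concavity of [t ^ theta], with free weights: Young's inequality gives
    [g ^ (1 - theta) * (x / X) ^ theta <= (1 - theta) * g + theta * (x / X)]. *)
Lemma sum_powR_lt1 (N : nat) (x g : nat -> R) (theta : R) : 0 < theta < 1 ->
  (forall i, 0 <= x i) -> (forall i, 0 <= g i) -> \sum_(i < N) g i <= 1 ->
  \sum_(i < N) g i `^ (1 - theta) * x i `^ theta <= (\sum_(i < N) x i) `^ theta.
Proof.
move=> /andP[t0 t1] x0 g0 g1; set X := \sum_(i < N) x i.
have X0 : 0 <= X by apply: sumr_ge0.
have [XE|Xn0] := eqVneq X 0.
  rewrite big1 ?powR_ge0// => i _; have -> : x i = 0.
    by apply/eqP; move/eqP : XE; rewrite /X psumr_eq0// => /allP/(_ i); rewrite mem_index_enum => /(_ isT).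
  by rewrite powR0 ?mulr0// gt_eqF.
have Xp : 0 < X by rewrite lt_neqAle eq_sym Xn0.
have t1' : 0 < 1 - theta by rewrite subr_gt0.
have step i : g i `^ (1 - theta) * x i `^ theta <=
    X `^ theta * ((1 - theta) * g i + theta * (x i / X)).
  have -> : x i `^ theta = X `^ theta * (x i / X) `^ theta.
    by rewrite -powRM ?divr_ge0// mulrCA mulfV// mulr1.
  rewrite mulrCA ler_wpM2l ?powR_ge0//.
  have := @conjugate_powR R (g i `^ (1 - theta)) ((x i / X) `^ theta)
    (1 - theta)^-1 theta^-1 (powR_ge0 _ _) (powR_ge0 _ _).
  rewrite !invr_gt0 t0 t1' !invrK subrK => /(_ isT isT erefl).
  by rewrite -!powRrM !mulfV ?gt_eqF// !powRr1 ?divr_ge0// [g i * _]mulrC [x i / X * theta]mulrC.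
apply: (le_trans (ler_sum _ (fun (i : 'I_N) _ => step i))).
rewrite -mulr_sumr -[leRHS]mulr1 ler_wpM2l ?powR_ge0// big_split/= -!mulr_sumr -mulr_suml.
rewrite mulfV// mulr1 -[leRHS](subrK theta) lerD2r.
by rewrite -[leRHS]mulr1 ler_wpM2l// ltW.
Qed.

Local Open Scope ereal_scope.

(** What sums and integrals have in common. The integral of a nonnegative
    function is a supremum over simple functions below it, so that on all
    nonnegative functions, measurable or not, it is superadditive. *)
Definition superlinear (J : Type) (Phi : (J -> R) -> \bar R) :=
  [/\ forall x, (forall j, 0 <= x j)%R -> 0 <= Phi x,
      forall x y, (forall j, 0 <= x j)%R -> (forall j, x j <= y j)%R -> Phi x <= Phi y,
      forall x y, (forall j, 0 <= x j)%R -> (forall j, 0 <= y j)%R ->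
        Phi x + Phi y <= Phi (fun j => x j + y j)%R
    & forall (k : R) x, (0 < k)%R -> (forall j, 0 <= x j)%R ->
        k%:E * Phi x <= Phi (fun j => k * x j)%R].

Lemma superlinear_sum J (Phi : (J -> R) -> \bar R) N (x : nat -> J -> R) :
  superlinear Phi -> (forall i j, 0 <= x i j)%R ->
  \sum_(i < N) Phi (x i) <= Phi (fun j => \sum_(i < N) x i j)%R.
Proof.
move=> [P0 Pm Pa _] x0; elim: N => [|N IH].
  by rewrite big_ord0; apply: P0 => j; rewrite big_ord0.
rewrite big_ord_recr/=; apply: (le_trans (leeD2r _ IH)).
rewrite (_ : (fun j => \sum_(i < N.+1) x i j)%R =
  (fun j => \sum_(i < N) x i j + x N j)%R); last first.
  by apply/funext => j; rewrite big_ord_recr.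
by apply: Pa => // j; apply: sumr_ge0.
Qed.

(** The reverse Minkowski inequality
    [sum_i |x_i|_theta <= |sum_i x_i|_theta] for [theta < 1] and superadditivity
    of [t ^ theta] for [theta >= 1], in one statement. *)
Lemma reverse_minkowski J (Phi : (J -> R) -> \bar R) N (x : nat -> J -> R)
    (y : J -> R) (theta : R) : superlinear Phi -> (0 < theta)%R ->
  (forall i j, 0 <= x i j)%R -> (forall j, \sum_(i < N) x i j <= y j)%R ->
  \sum_(i < N) Phi (fun j => x i j `^ theta)%R `^ (Num.max 1 theta^-1)%R <=
    Phi (fun j => y j `^ theta)%R `^ (Num.max 1 theta^-1)%R.
Proof.
move=> HP t0 x0 xy; have [P0 Pm Pa Pk] := HP.
have xp i j : (0 <= x i j `^ theta)%R by exact: powR_ge0.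
have xs j : (0 <= \sum_(i < N) x i j)%R by apply: sumr_ge0.
have mono : Phi (fun j => (\sum_(i < N) x i j) `^ theta)%R <= Phi (fun j => y j `^ theta)%R.
  apply: Pm => j; first exact: powR_ge0.
  by rewrite ge0_ler_powR ?nnegrE ?(ltW t0)// (le_trans (xs j)).
have [t1|t1] := leP (1:R)%R theta.
  have -> : (Num.max 1 theta^-1)%R = 1%R by apply/max_idPl; rewrite invf_le1.
  rewrite poweRe1; last by apply: P0 => j; exact: powR_ge0.
  rewrite (eq_bigr (fun i : 'I_N => Phi (fun j => x i j `^ theta)%R)) => [|i _]; last first.
    by rewrite poweRe1//; exact: P0.
  apply: (le_trans (superlinear_sum N (x := fun i j => x i j `^ theta)%R HP _)) => //.
  apply: le_trans mono; apply: Pm => j; first by apply: sumr_ge0.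
  by apply: (@sum_powR_ge1 N (fun i => x i j)).
have -> : (Num.max 1 theta^-1)%R = (theta^-1)%R.
  by apply/max_idPr; rewrite invf_ge1// ltW.
have ti0 : (theta^-1 != 0)%R by rewrite invr_neq0// gt_eqF.
have S0 : 0 <= Phi (fun j => y j `^ theta)%R by apply: P0 => j; exact: powR_ge0.
case ES : (Phi (fun j => y j `^ theta)%R) S0 => [S| |//] S0; last first.
  by rewrite poweRyr// leey.
(* [Z ^ theta <= S] is the pointwise inequality [sum_powR_lt1] integrated with
   the weights [g i] that make it sharp, those proportional to [t i ^ theta^-1]. *)
have /choice[t Ht] : forall i, exists t : R, (i < N)%N ->
    (0 <= t)%R /\ Phi (fun j => x i j `^ theta)%R = t%:E.
  move=> i; have [iN|] := boolP (i < N)%N; last by exists 0%R.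
  have := P0 _ (xp i); have : Phi (fun j => x i j `^ theta)%R <= S%:E.
    rewrite -ES; apply: le_trans mono; apply: Pm => // j.
    rewrite ge0_ler_powR ?nnegrE ?(ltW t0)//.
    by rewrite (bigD1 (Ordinal iN))//= lerDl sumr_ge0.
  by case: (Phi _) => // t _ tge; exists t => _.
rewrite (eq_bigr (fun i : 'I_N => (t i `^ theta^-1)%R%:E)) => [|i _]; last first.
  by have [_ ->] := Ht i (ltn_ord i).
rewrite sumEFin poweR_EFin lee_fin.
set Z := (\sum_(i < N) _)%R.
have Z0 : (0 <= Z)%R by apply: sumr_ge0 => i _; exact: powR_ge0.
have [->|Zn0] := eqVneq Z 0%R; first exact: powR_ge0.
have Zp : (0 < Z)%R by rewrite lt_neqAle eq_sym Zn0.
suff ZS : (Z `^ theta <= S)%R.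
  rewrite -[X in (X <= _)%R]powRr1// -(mulfV (lt0r_neq0 t0)) powRrM.
  by rewrite ge0_ler_powR ?nnegrE ?powR_ge0 ?invr_ge0 ?(ltW t0).
pose g i := (t i `^ theta^-1 / Z)%R.
have g0 i : (0 <= g i)%R by rewrite divr_ge0// powR_ge0.
have g1 : (\sum_(i < N) g i <= 1)%R by rewrite -mulr_suml mulfV.
have tt i : (i < N)%N -> (g i `^ (1 - theta) * t i = t i `^ theta^-1 / Z `^ (1 - theta))%R.
  move=> iN; have [ti _] := Ht i iN.
  rewrite /g powRM ?powR_ge0 ?invr_ge0// -(powR_inv1 Z0) -!powRrM mulN1r powRN.
  rewrite mulrAC; congr (_ / _)%R.
  have [->|tn0] := eqVneq (t i) 0%R; first by rewrite mulr0 powR0.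
  rewrite -{2}(powRr1 ti) -powRD ?tn0 ?implybT//; congr (_ `^ _)%R.
  by field; rewrite gt_eqF.
rewrite -lee_fin.
have -> : (Z `^ theta)%:E = \sum_(i < N) (g i `^ (1 - theta))%:E * Phi (fun j => x i j `^ theta)%R.
  rewrite (eq_bigr (fun i : 'I_N => (t i `^ theta^-1 / Z `^ (1 - theta))%:E)) => [|i _]; last first.
    by have [_ ->] := Ht i (ltn_ord i); rewrite -EFinM tt.
  rewrite sumEFin -mulr_suml -/Z; congr (_%:E).
  by rewrite -{2}(powRr1 Z0) -powRN -powRD ?Zn0 ?implybT//; congr (_ `^ _)%R; ring.
apply: (@le_trans _ _ (\sum_(i < N) Phi (fun j => g i `^ (1 - theta) * x i j `^ theta)%R)).
  apply: lee_sum => i _; have [g00|gp] := eqVneq (g i `^ (1 - theta))%R 0%R.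
    by rewrite g00 mul0e; apply: P0 => j; rewrite mul0r.
  by apply: Pk => //; rewrite lt_neqAle eq_sym gp powR_ge0.
apply: (le_trans (superlinear_sum N (x := fun i j => g i `^ (1 - theta) * x i j `^ theta)%R HP _)).
  by move=> i j; rewrite mulr_ge0 ?powR_ge0.
rewrite -ES; apply: le_trans mono; apply: Pm => j.
  by apply: sumr_ge0 => i _; rewrite mulr_ge0 ?powR_ge0.
by apply: (@sum_powR_lt1 N (fun i => x i j)); rewrite ?t0.
Qed.

End SuperadditiveFunctionals.

(** * Sums and lower integrals *)

Section Functionals.
Import HBNNSimple.
Variable R : realType.
Local Open Scope ereal_scope.

Lemma ereal_sup_add_le (A B : set (\bar R)) (y : \bar R) :
  A 0 -> B 0 -> (forall x, A x -> 0 <= x) -> (forall x, B x -> 0 <= x) ->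
  (forall x x', A x -> B x' -> x + x' <= y) -> ereal_sup A + ereal_sup B <= y.
Proof.
move=> A0 B0 Age Bge AB.
case: y AB => [y| |] AB; last 2 first.
- by rewrite leey.
- by have := AB _ _ A0 B0; rewrite adde0.
have Bfin x : B x -> x \is a fin_num.
  move=> Bx; rewrite ge0_fin_numE ?Bge//.
  by have := AB _ _ A0 Bx; rewrite add0e => /le_lt_trans; apply; rewrite ltry.
have supA x : B x -> ereal_sup A <= y%:E - x.
  by move=> Bx; apply: ge_ereal_sup => a Aa; rewrite leeBrDr ?Bfin//; exact: AB.
have Afin : ereal_sup A \is a fin_num.
  rewrite ge0_fin_numE ?ereal_sup_ubound//.
  by apply: (le_lt_trans (supA _ B0)); rewrite sube0 ltry.
rewrite -leeBrDl//; apply: ge_ereal_sup => x Bx.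
by rewrite leeBrDl// -leeBrDr ?Bfin//; exact: supA.
Qed.

Lemma superlinear_sup (k : R) (S : set (\bar R)) (y : \bar R) : (0 < k)%R ->
  (forall e, S e -> k%:E * e <= y) -> k%:E * ereal_sup S <= y.
Proof.
move=> k0 H; rewrite -lee_pdivlMl//; apply: ge_ereal_sup => e /H.
by rewrite lee_pdivlMl.
Qed.

Lemma esum_superlinear (J : choiceType) :
  superlinear (fun x : J -> R => \esum_(j in [set: J]) (x j)%:E).
Proof.
split=> [x x0|x y x0 xy|x y x0 y0|k x k0 x0].
- by apply: esum_ge0 => j _; rewrite lee_fin.
- by apply: le_esum => j _; rewrite lee_fin.
- under [leRHS]eq_esum do rewrite EFinD.
  by rewrite esumD// => j _; rewrite lee_fin.
- apply: superlinear_sup => // _ [A AS <-]; apply: esum_ge; exists A => //.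
  rewrite ge0_mule_fsumr => [|j]; last by rewrite lee_fin.
  by apply: lee_fsum; [case: AS|move=> j _; rewrite EFinM].
Qed.

Lemma integral_superlinear d (T : measurableType d) (mu : {measure set T -> \bar R}) :
  superlinear (fun x : T -> R => \int[mu]_t (x t)%:E).
Proof.
have E x : (forall t, 0 <= x t)%R -> \int[mu]_t (x t)%:E = ereal_sup [set sintegral mu h |
    h in [set h : {nnsfun T >-> R} | forall t, (h t)%:E <= (x t)%:E]].
  by move=> x0; rewrite ge0_integralTE// => t; rewrite lee_fin.
split=> [x x0|x y x0 xy|x y x0 y0|k x k0 x0].
- by apply: integral_ge0 => t _; rewrite lee_fin.
- rewrite !E//; last by move=> t; exact: le_trans (xy t).
  apply: ereal_sup_le => _ [h hx <-]; exists h => // t /=.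
  by apply: (le_trans (hx t)); rewrite lee_fin.
- rewrite !E//; last by move=> t; rewrite addr_ge0.
  have mem0 (z : T -> R) : (forall t, 0 <= z t)%R -> [set sintegral mu h |
      h in [set h : {nnsfun T >-> R} | forall t, (h t)%:E <= (z t)%:E]] 0.
    move=> z0; exists nnsfun0; last exact: sintegral0.
    by move=> t /=; rewrite lee_fin.
  have ge0 (z : T -> R) e : [set sintegral mu h |
      h in [set h : {nnsfun T >-> R} | forall t, (h t)%:E <= (z t)%:E]] e -> 0 <= e.
    by move=> [h _ <-]; exact: sintegral_ge0.
  apply: ereal_sup_add_le; [exact: mem0|exact: mem0|exact: ge0|exact: ge0|].
  move=> _ _ [h hx <-] [k ky <-]; rewrite -sintegralD//.
  apply: ereal_sup_ubound; exists (add_nnsfun h k) => // t /=.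
  have := hx t; have := ky t; rewrite !lee_fin => *; exact: lerD.
- rewrite !E//; last by move=> t; rewrite mulr_ge0// ltW.
  apply: superlinear_sup => // _ [h hx <-].
  apply: ereal_sup_ubound; rewrite -sintegralrM.
  exists (scale_nnsfun h (ltW k0)) => // t /=.
  by rewrite lee_fin ler_wpM2l ?(ltW k0)//; have := hx t; rewrite lee_fin.
Qed.

End Functionals.

(** * Wavelet norms of disjoint blocks *)

Section WaveletNorm.
Variables (R : realType) (d : nat) (c : scalars) (E : finType).
Local Notation K := (Defs.scalar R c).
Local Notation coeffs := (nabla d -> E -> K).
Implicit Types (b : coeffs) (G : {fset nabla d}).

Lemma esum_seq (I : choiceType) (s : seq I) (f : I -> R) : uniq s ->
  (forall i, 0 <= f i) -> (forall i, i \notin s -> f i = 0) ->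
  (\esum_(i in [set: I]) (f i)%:E = (\sum_(i <- s) f i)%:E)%E.
Proof.
move=> us f0 fs; rewrite -sumEFin fsbig_seq//.
rewrite -esum_fset => [||i _]; [|exact: finite_seq|by rewrite lee_fin].
rewrite [RHS]esum_mkcond; apply: eq_esum => i _.
by case: ifPn => //; rewrite notin_setE/= => /negP/fs ->.
Qed.

Lemma lnorm_seq (I : choiceType) (s : seq I) (f : I -> R) (q : R) : uniq s ->
  0 < q -> (forall i, 0 <= f i) -> (forall i, i \notin s -> f i = 0) ->
  lnorm q%:E (fun i => (f i)%:E) = ((\sum_(i <- s) f i `^ q) `^ q^-1)%:E.
Proof.
move=> us q0 f0 fs; rewrite /lnorm.
rewrite (_ : (\esum_(i in _) _)%E = (\sum_(i <- s) f i `^ q)%:E)//.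
rewrite -esum_seq// => i; first exact: powR_ge0.
by move=> /fs ->; rewrite powR0// gt_eqF.
Qed.

Definition supported b G := forall lam, lam \notin G -> b lam = 0.

Definition part (color : nabla d -> nat) b (i : nat) : coeffs :=
  fun lam => if color lam == i then b lam else 0.

Lemma part_supported color b i G : supported b G -> supported (part color b i) G.
Proof. by move=> bG lam /bG b0; rewrite /part b0; case: ifP. Qed.

Lemma sum_part color b N lam (h : R -> R) : h 0 = 0 -> (forall x, 0 <= h x) ->
  \sum_(i < N) h (vmod (part color b i lam)) <= h (vmod (b lam)).
Proof.
move=> h0 hge; have [cN|Nc] := ltnP (color lam) N.
  rewrite (bigD1 (Ordinal cN))//= big1 => [|i].
    by rewrite /part eqxx addr0.
  by move=> /negbTE ic; rewrite /part eq_sym -[color lam]/(nat_of_ord (Ordinal cN)) val_eqE ic vmod0.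
rewrite big1// => i _; rewrite /part; case: eqP => [ci|_]; last by rewrite vmod0.
by move: (ltn_ord i); rewrite -ci ltnNge Nc.
Qed.

Lemma besov_normE p q b G : 0 < p -> 0 < q -> supported b G ->
  wavelet_norm Besov p q%:E b =
  ((\esum_(j in [set: int]) ((\sum_(k <- undup [seq lam.2 | lam <- enum_fset G])
     vmod (b (j, k)) `^ p) `^ (q / p))%:E) `^ q^-1)%E.
Proof.
move=> p0 q0 bG; rewrite /wavelet_norm {1}/lnorm; congr (_ `^ _)%E.
apply: eq_esum => j _; rewrite (@lnorm_seq _ (undup [seq lam.2 | lam <- enum_fset G])).
- by rewrite poweR_EFin -powRrM mulrC.
- exact: undup_uniq.
- by [].
- by move=> k; exact: vmod_ge0.
- move=> k kG; rewrite bG ?vmod0//; apply: contra kG => jkG.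
  by rewrite mem_undup; apply/mapP; exists (j, k).
Qed.

Lemma chi_ge0 p lam (x : 'rV[R]_d) : 0 <= chi p lam x.
Proof. by rewrite /chi mulr_ge0 ?powR_ge0. Qed.

Lemma triebel_normE p q b G : 0 < p -> 0 < q -> supported b G ->
  wavelet_norm TriebelLizorkin p q%:E b =
  ((\int[@leb R d]_t ((\sum_(lam <- enum_fset G)
     (vmod (b lam) * chi p lam (rvec t)) `^ q) `^ (p / q))%:E) `^ p^-1)%E.
Proof.
move=> p0 q0 bG; rewrite /wavelet_norm unlock; congr (_ `^ _)%E.
apply: eq_integral => t _; rewrite (@lnorm_seq _ (enum_fset G)).
- by rewrite /= ger0_norm ?powR_ge0// -powRrM mulrC.
- exact: fset_uniq.
- by [].
- by move=> lam; rewrite mulr_ge0 ?vmod_ge0 ?chi_ge0.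
- by move=> lam lG; rewrite bG// vmod0 mul0r.
Qed.

(** Blocks with disjoint supports have additive inner sums (of the [p]-th powers
    in the Besov case, of the [q]-th powers in the Triebel-Lizorkin case). The
    outer functional then falls under [reverse_minkowski], with [theta = q / p],
    respectively [theta = p / q]; both give the exponent [max p q]. *)
Lemma wavelet_norm_parts fam p q b G color N : 0 < p -> 0 < q -> supported b G ->
  (\sum_(i < N) wavelet_norm fam p q%:E (part color b i) `^ (Num.max p q)
    <= wavelet_norm fam p q%:E b `^ (Num.max p q))%E.
Proof.
move=> p0 q0 bG.
have maxE (x y : R) : 0 < x -> 0 < y -> x^-1 * Num.max x y = Num.max 1 (y / x)^-1^-1.
  move=> x0 y0; rewrite invrK maxr_pMr ?invr_ge0 ?ltW//. by rewrite mulVf ?gt_eqF// mulrC.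
have tp := fun i => part_supported color i bG.
case: fam.
  rewrite (besov_normE p0 q0 bG) -poweRrM maxC maxE// invf_div.
  under eq_bigr do rewrite (besov_normE p0 q0 (tp _)) -poweRrM maxE// invf_div.
  pose x b j : R := \sum_(k <- undup [seq lam.2 | lam <- enum_fset G]) vmod (b (j, k)) `^ p.
  apply: (@reverse_minkowski R _ _ N (fun i => x (part color b i)) (x b) (q / p)
    (esum_superlinear R int)).
  - exact: divr_gt0.
  - by move=> i j; apply: sumr_ge0 => k _; exact: powR_ge0.
  - move=> j; rewrite /x exchange_big/=; apply: ler_sum => k _.
    apply: (sum_part color b N (j, k) (h := fun x => x `^ p)) => [|y].
      by rewrite powR0// gt_eqF.
    exact: powR_ge0.
rewrite (triebel_normE p0 q0 bG) -poweRrM maxE// invf_div.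
under eq_bigr do rewrite (triebel_normE p0 q0 (tp _)) -poweRrM maxE// invf_div.
pose x b t : R := \sum_(lam <- enum_fset G) (vmod (b lam) * chi p lam (rvec t)) `^ q.
apply: (@reverse_minkowski R _ _ N (fun i => x (part color b i)) (x b) (p / q)
  (integral_superlinear (@leb R d))).
- exact: divr_gt0.
- by move=> i j; apply: sumr_ge0 => k _; exact: powR_ge0.
- move=> t; rewrite /x exchange_big/=; apply: ler_sum => lam _.
  apply: (sum_part color b N lam (h := fun x => (x * chi p lam (rvec t)) `^ q)) => [|y].
    by rewrite mul0r powR0// gt_eqF.
  exact: powR_ge0.
Qed.

End WaveletNorm.

(** * The lower estimate in X *)

Section LowerEstimate.
Variables (R : realType) (d : nat) (c : scalars) (r : R) (E : finType).
Variables (psi : E -> distr R d c) (X : fspace R d c).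
Hypothesis HX : function_space r X.
Hypothesis UX : unconditional_basis r psi X.
Local Notation K := (Defs.scalar R c).
Local Notation coeffs := (nabla d -> E -> K).
Local Notation wsum := (wsum r psi).
Local Notation wterm := (wterm r psi).

(** The blocks are the classes of a colouring of the ranks, which makes them
    disjoint by construction. *)
Definition lower_estimate (tau C : R) := forall (b : coeffs) nu M N (col : nat -> nat),
  injective nu ->
  \sum_(i < N) fnorm X (\sum_(0 <= m < M | col m == i) wterm b (nu m)) `^ tau
    <= C * fnorm X (\sum_(0 <= m < M) wterm b (nu m)) `^ tau.

Lemma wsum0 (b : coeffs) nu M P : (forall e : E, False) ->
  \sum_(0 <= m < M | P m) wterm b (nu m) = 0.
Proof.
by move=> noE; rewrite big1// => m _; rewrite /Defs.wterm big1// => e; case: (noE e).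
Qed.

Lemma lower_estimate_empty tau : 0 < tau -> (forall e : E, False) -> lower_estimate tau 0.
Proof.
move=> t0 noE b nu M N col _; rewrite mul0r big1// => i _.
by rewrite wsum0// (fnorm0 HX) powR0// gt_eqF.
Qed.

Lemma lower_estimate_finite fam p q : 1 <= p -> 1 <= q ->
  wavelet_characterization r psi fam p q%:E X ->
  exists2 C, 0 <= C & lower_estimate (Num.max p q) C.
Proof.
move=> p1 q1 [A A0 HA]; set tau := Num.max p q.
have t0 : 0 < tau by rewrite (lt_le_trans ltr01)// /tau le_max p1.
have pX := atom_dom UX.
exists (A `^ tau * A `^ tau); first by rewrite mulr_ge0 ?powR_ge0.
move=> b nu M N col inj.
have /choice[color Hcolor] : forall lam, exists k, forall m, nu m = lam -> col m = k.
  move=> lam; have [[m mE]|nolam] := pselect (exists m, nu m = lam).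
    by exists (col m) => m'; rewrite -mE => /inj ->.
  by exists 0 => m mE; case: nolam; exists m.
set G := initial nu M xpredT; set bG := coeffs_on b G.
have bGG : supported bG G by move=> lam /negbTE lG; rewrite /bG /coeffs_on lG.
have partE i : part color bG i = coeffs_on b (initial nu M (fun m => col m == i)).
  apply/funext => lam; rewrite /part /bG /coeffs_on.
  have [/initialP[m [mM /= /eqP cm lE]]|lI] := boolP (lam \in initial nu M (fun m => col m == i)).
    rewrite -(Hcolor lam m)// cm eqxx ifT//.
    by apply/initialP; exists m; split.
  case: ifP => // ci; case: ifP => // /initialP[m [mM _ lE]].
  case/negP : lI; apply/initialP; exists m; split => //=.
  by rewrite (Hcolor lam m).
pose f (i : nat) : distr R d c := \sum_(0 <= m < M | col m == i) wterm b (nu m).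
pose g : distr R d c := \sum_(0 <= m < M) wterm b (nu m).
have fX i : fdom X (f i) by apply: (fdom_sum HX) => m _; exact: (wterm_dom HX pX).
have gX : fdom X g by apply: (fdom_sum HX) => m _; exact: (wterm_dom HX pX).
have fexp i : expansion r psi X (f i) (part color bG i).
  by rewrite partE /f -wsum_initial//; exact: expansion_wsum.
have gexp : expansion r psi X g bG.
  by rewrite /g -wsum_initial//; exact: expansion_wsum.
have N0 h : fdom X h -> 0 <= fnorm X h by exact: (fnorm_ge0 HX).
rewrite -lee_fin -sumEFin.
pose W (b : coeffs) := wavelet_norm fam p q%:E b.
have W0 b' : (0 <= W b')%E.
  by rewrite /W /wavelet_norm; case: (fam); rewrite ?Lnorm_ge0// /lnorm poweR_ge0.
have inI (x : \bar R) : (0 <= x)%E -> x \in `[0%E, +oo%E].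
  by move=> x0; rewrite in_itv/= x0 leey.
apply: (@le_trans _ _ ((A `^ tau)%:E * \sum_(i < N) W (part color bG i) `^ tau)%E).
  rewrite ge0_sume_distrr => [|i _]; last exact: poweR_ge0.
  apply: lee_sum => i _; have [_ fle] := HA _ _ (fX i) (fexp i).
  rewrite -[(A `^ tau)%:E]/(A%:E `^ tau)%E -poweRM ?W0 ?lee_fin ?(ltW A0)//.
  rewrite -[leLHS]/((fnorm X (f i))%:E `^ tau)%E.
  apply: gt0_ler_poweR => //; first exact: ltW.
    by apply: inI; rewrite lee_fin N0.
  by apply: inI; rewrite mule_ge0// lee_fin ltW.
apply: (@le_trans _ _ ((A `^ tau)%:E * W bG `^ tau)%E).
  rewrite lee_pmul2l ?lte_fin ?powR_gt0//.
  by apply: (@wavelet_norm_parts _ _ _ _ _ _ _ _ G); rewrite // (lt_le_trans ltr01).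
rewrite -mulrA EFinM lee_pmul2l ?lte_fin ?powR_gt0//.
have [gle _] := HA _ _ gX gexp.
rewrite -powRM ?N0 ?(ltW A0)//.
rewrite -[leRHS]/((A * fnorm X g)%:E `^ tau)%E.
apply: (gt0_ler_poweR (ltW t0)) => //; apply: inI => //.
by rewrite lee_fin mulr_ge0 ?N0 ?(ltW A0).
Qed.

End LowerEstimate.

(** * The endpoint a = infinity *)

Section EndpointCase.
Variables (R : realType) (d : nat) (c : scalars) (r : R) (E : finType).
Variables (psi : E -> distr R d c) (X : fspace R d c).
Hypothesis HX : function_space r X.
Hypothesis UX : unconditional_basis r psi X.
Local Notation K := (Defs.scalar R c).
Local Notation coeffs := (nabla d -> E -> K).
Local Notation wsum := (wsum r psi).
Local Notation wterm := (wterm r psi).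

(** Under Assumption 2 the coordinatewise limit [b] of bounded wavelet sums is the
    coefficient family of a convergent expansion, and blocks of a convergent
    expansion tend to 0. *)
Lemma no_bounded_divergent (b : coeffs) (H : nat -> {fset nabla d}) (B eps : R) :
  assumption2 r psi X -> 0 < eps -> (forall n, fnorm X (wsum b (H n)) <= B) ->
  (forall lam, b lam <> 0 -> exists N : nat, forall n, (N <= n)%N -> lam \in H n) ->
  (forall F, exists F', [disjoint F & F']%fset /\ eps <= fnorm X (wsum b F')) ->
  False.
Proof.
move=> [C0 HC] eps0 HB Hlim Hblock.
have wX := wsum_dom HX (atom_dom UX).
have [||||g [gX gb _]] := HC (fun n => wsum b (H n)) (fun n => coeffs_on b (H n)) b.
- by [].
- by exists B.
- by move=> n; exact: expansion_wsum.
- move=> lam e; apply/cvgnP => del del0.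
  have [b0|/Hlim[N HN]] := pselect (b lam = 0).
    exists 0 => n _; rewrite /coeffs_on b0 if_same subrr modulus0 subr0 normr0.
    exact: ltW.
  exists N => n /HN lH; rewrite /coeffs_on lH subrr modulus0 subr0 normr0.
  exact: ltW.
have e20 : 0 < eps / 2 by rewrite divr_gt0.
have [F HF] := gb _ e20; have [F' [FF' eF']] := Hblock F.
have := HF F (fsubset_refl F); have := HF _ (fsubsetUl F F').
rewrite wsumU// => lt1 lt2.
have : fnorm X (wsum b F') < eps.
  have -> : wsum b F' = (g - wsum b F) - (g - (wsum b F + wsum b F')).
    by rewrite opprB [RHS]addrC addrA subrK addrAC subrr add0r.
  rewrite (splitr eps); apply: le_lt_trans (ltrD lt2 lt1).
  by apply: (fnormB HX); apply: (fdomB HX) => //; exact: (fdomD HX).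
by rewrite ltNge eF'.
Qed.

(** One wavelet at each scale: the norm of such a sum is equivalent to the
    supremum of the coefficients. *)
Lemma besov_infty p : 1 <= p -> wavelet_characterization r psi Besov p +oo%E X ->
  assumption2 r psi X -> forall e : E, False.
Proof.
move=> p1 [A A0 HA] A2 e0.
have p0 : 0 < p by exact: lt_le_trans p1.
pose h (lam : nabla d) : R := ((0 <= lam.1) && (lam.2 == 0))%:R.
pose b := single c e0 h; pose nu (m : nat) : nabla d := (m%:Z, 0).
have nuinj : injective nu by move=> m n [].
have bnu m : wterm b (nu m) = rescale r (psi e0) (nu m).
  by rewrite wterm_single /h/= eqxx of_real1 scale1r.
apply: (@no_bounded_divergent b (fun n => initial nu n xpredT) A (fnorm X (psi e0))) => //.
- exact: (psi_norm_gt0 HX UX).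
- move=> n; have wX := wsum_dom HX (atom_dom UX) b (initial nu n xpredT).
  have [_] := HA _ _ wX (expansion_wsum psi HX b (initial nu n xpredT)).
  rewrite -lee_fin => /le_trans; apply; rewrite -[leRHS]mule1 lee_pmul2l//.
  apply: ge_ereal_sup => _ [j _ <-].
  rewrite (@lnorm_seq _ _ [:: 0])//.
  + rewrite big_seq1 -powRrM mulfV ?gt_eqF// powRr1 ?vmod_ge0// lee_fin.
    rewrite /coeffs_on; case: ifP => _; last by rewrite vmod0.
    by rewrite vmod_single /h; case: (_ && _); rewrite ?normr1 ?normr0.
  + by move=> k; exact: vmod_ge0.
  + move=> k; rewrite inE => k0; rewrite /coeffs_on ifF ?vmod0//.
    by apply/negP => /initialP[m [_ _ [_ /eqP]]]; rewrite (negbTE k0).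
- move=> lam b0; exists (absz lam.1).+1 => n Nn; apply/initialP; exists (absz lam.1).
  split => //; case: lam b0 Nn => j k /= b0 _.
  have [hn0|] := eqVneq (h (j, k)) 0.
    by case: b0; apply: vmod_eq0; rewrite vmod_single hn0 normr0.
  rewrite /h/= pnatr_eq0 eqb0 negbK => /andP[j0 /eqP ->].
  by rewrite /nu gez0_abs.
- move=> F; have [m mF] : exists m, nu m \notin F.
    apply: contrapT => /forallNP all.
    have : (#|` initial nu (#|`F|).+1 xpredT| <= #|`F|)%N.
      apply: fsubset_leq_card; apply/fsubsetP => lam /initialP[m [_ _ ->]].
      by apply/negPn/negP; exact: all.
    by rewrite card_initial// ltnn.
  exists [fset nu m]%fset; rewrite fdisjointX1 mF wsum_fset1 bnu (rescale_norm HX)//.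
  exact: (psi_dom UX).
Qed.

End EndpointCase.

Section DyadicCubes.
Variables (R : realType) (d : nat) (p : R).
Implicit Types (lam : nabla d) (x : 'rV[R]_d) (k : 'rV[int]_d) (F : {fset nabla d}).

Definition in_unit_cube lam : bool :=
  (0 <= lam.1) && [forall i, (0 <= lam.2 0 i) && (lam.2 0 i < 2 ^+ absz lam.1)].

Definition touches lam x : bool :=
  [forall i, 0 <= (2 ^ lam.1 *: x - intvec R lam.2) 0 i <= 1].

Lemma PoszX2 (j : nat) : (2 ^+ j : int) = (2 ^ j)%N%:Z.
Proof. by rewrite -natz natrX. Qed.

Definition level (j : nat) : seq (nabla d) :=
  [seq (j%:Z, \row_i (nat_of_ord (v i))%:Z) | v : {ffun 'I_d -> 'I_(2 ^ j)} <- enum {: {ffun 'I_d -> 'I_(2 ^ j)}}].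

Lemma mem_level j lam : (lam \in level j) = (lam.1 == j%:Z) && in_unit_cube lam.
Proof.
apply/mapP/andP => [[v _ ->]|[/eqP jE /andP[_ /forallP lE]]].
  rewrite eqxx; split => //; apply/andP; split => //=; apply/forallP => i.
  by rewrite mxE /= PoszX2 ltz_nat ltn_ord.
have /choice[v Hv] : forall i, exists o : 'I_(2 ^ j), lam.2 0 i = (nat_of_ord o)%:Z.
  move=> i; have := lE i; rewrite jE absz_nat => /andP[l0].
  rewrite -(gez0_abs l0) PoszX2 ltz_nat => lt2.
  by exists (Ordinal lt2); rewrite /= gez0_abs.
exists [ffun i => v i]; first by rewrite mem_enum.
by case: lam jE Hv {lE} => l k /= -> Hv; congr pair; apply/rowP => i; rewrite mxE ffunE.
Qed.

(** The coefficient that turns [chi] into an indicator function. *)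
Definition cube_height lam : R :=
  if in_unit_cube lam then 2 `^ (- (d%:R * lam.1%:~R / p)) else 0.

Lemma cube_height_ge0 lam : 0 <= cube_height lam.
Proof. by rewrite /cube_height; case: ifP => // _; exact: powR_ge0. Qed.

Lemma cube_heightE lam x :
  cube_height lam * chi p lam x = (in_unit_cube lam && touches lam x)%:R.
Proof.
rewrite /cube_height; case: ifP => _; last by rewrite mul0r.
by rewrite /chi mulrA -powRD ?addNr ?powRr0 ?mul1r// pnatr_eq0 implybT.
Qed.

(** The value at [x] of the Triebel-Lizorkin square function, for [a = +oo], of
    the cubes belonging to [F]. *)
Definition cube_sup F x : \bar R := ereal_sup (range (fun j : int =>
  \esum_(k in [set: 'rV[int]_d])
    (((j, k) \in F)%:R * (cube_height (j, k) * chi p (j, k) x))%:E)).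

(** At each scale a point belongs to at most [2 ^ d] closed dyadic cubes. *)
Lemma cube_sup_le F x : (cube_sup F x <= (2 ^+ d * (touches (0, 0) x)%:R)%:E)%E.
Proof.
apply: ge_ereal_sup => _ [j _ <-].
pose s := undup [seq \row_i (Num.floor ((2 ^ j *: x) 0 i) - (nat_of_bool (v i))%:Z)
  | v : {ffun 'I_d -> bool} <- enum {: {ffun 'I_d -> bool}}].
have s_size : (size s <= 2 ^ d)%N.
  apply: (leq_trans (size_undup _)); rewrite size_map -cardE card_ffun card_bool.
  by rewrite card_ord.
rewrite (@esum_seq _ _ s) ?undup_uniq//; last 2 first.
- by move=> k; rewrite cube_heightE mulr_ge0.
- move=> k ks; rewrite cube_heightE; case: (boolP (_ && _)) => [|_]; last by rewrite mulr0.
  move=> /andP[_ /forallP /= tk]; case/negP : ks; rewrite mem_undup.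
  apply/mapP; exists [ffun i => Num.floor ((2 ^ j *: x) 0 i) != k 0 i].
    by rewrite mem_enum.
  apply/rowP => i; rewrite !mxE ffunE.
  have := tk i; rewrite !mxE => /andP[]; set y := 2 ^ j * x 0 i.
  rewrite subr_ge0 lerBlDr => ky yk.
  (* A cube containing the point has its corner at the floor of the dilated point
   or one unit before, in each coordinate. *)
have lo : k 0 i <= Num.floor y by rewrite floor_ge_int.
  have hi : Num.floor y <= k 0 i + 1.
    rewrite -(ler_int R) intrD addrC.
    by apply: le_trans yk; exact: floor_le_tmp.
  case: eqP lo hi => /= [->|]; first by rewrite subr0.
  by move: (Num.floor y) (k 0 i) => u v; lia.
rewrite lee_fin; apply: (@le_trans _ _ (\sum_(k <- s) (touches (0, 0) x)%:R)).
  apply: ler_sum => k _; rewrite cube_heightE -natrM ler_nat mulnb.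
  case: (boolP (_ && _)) => // /and3P[_ /andP[/= j0 /forallP kbox] /forallP tk].
  rewrite (_ : touches _ _ = true)//; apply/forallP => i.
  have := tk i; have := kbox i; rewrite !mxE/= expr0z mul1r subr0.
  case: j j0 {tk kbox s s_size} => // n _ /andP[k0 k2] /andP[]; rewrite -exprnP.
  rewrite subr_ge0 lerBlDr => y0 y1.
  have p2 : (0 : R) < 2 ^+ n by rewrite exprn_gt0.
  rewrite -(pmulr_rge0 _ p2) (le_trans _ y0) ?ler0z//=.
  rewrite -(ler_pM2l p2) mulr1; apply: (le_trans y1).
  rewrite -(mulr1z (1 : R)) -intrD addrC; have -> : (2 : R) ^+ n = (2 ^+ n : int)%:~R.
    by rewrite rmorphXn.
  by rewrite ler_int; move: k2; rewrite absz_nat; lia.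
rewrite big_const_seq count_predT iter_addr addr0 -[leLHS]mulr_natl ler_wpM2r//.
by rewrite -natrX ler_nat.
Qed.

Lemma cube_sup_ge j x :
  ((touches (0, 0) x)%:R%:E <= cube_sup (seq_fset tt (level j)) x)%E.
Proof.
have nn (i : int) k : (0 <= (((i, k) \in seq_fset tt (level j))%:R *
    (cube_height (i, k) * chi p (i, k) x))%:E)%E.
  by rewrite lee_fin cube_heightE mulr_ge0.
case: (boolP (touches _ _)) => [/forallP Q|_]; last first.
  apply: (@le_trans _ _ (\esum_(k in [set: 'rV[int]_d])
    (((0, k) \in seq_fset tt (level j))%:R * (cube_height (0, k) * chi p (0, k) x))%:E)%E).
    by apply: esum_ge0.
  by apply: ereal_sup_ubound; exists 0.
have p2 : (0 : R) < 2 ^+ j by rewrite exprn_gt0.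
pose y i : R := 2 ^+ j * x 0 i.
have yQ i : 0 <= y i <= 2 ^+ j.
  have := Q i; rewrite !mxE/= expr0z mul1r subr0 => /andP[x0 x1].
  by rewrite mulr_ge0 ?(ltW p2)//= -[leRHS]mulr1 ler_pM2l.
(* The minimum accounts for points on the upper faces of the unit cube. *)
pose k : 'rV[int]_d := \row_i Num.min (Num.floor (y i)) (2 ^+ j - 1).
have E2 : (2 : R) ^+ j = (2 ^+ j : int)%:~R by rewrite rmorphXn.
have p2i : (0 : int) < 2 ^+ j by rewrite exprn_gt0.
have kc : in_unit_cube (j%:Z, k).
  apply/andP; split => //=; apply/forallP => i; rewrite mxE.
  have /andP[y0 y1] := yQ i; have f0 : 0 <= Num.floor (y i) by rewrite floor_ge0.
  by apply/andP; split; lia.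
have kt : touches (j%:Z, k) x.
  apply/forallP => i; rewrite !mxE/= -exprnP -/(y i) subr_ge0 lerBlDr.
  have /andP[y0 y1] := yQ i.
  have fy : (Num.floor (y i))%:~R <= y i by exact: floor_le_tmp.
  have yf : y i < (Num.floor (y i) + 1)%:~R by exact: floorD1_gt.
  case: (leP (Num.floor (y i)) (2 ^+ j - 1)) => [_|lt].
    by rewrite fy/= addrC; move: yf; rewrite intrD => /ltW.
  rewrite intrB -E2 [1 + _]addrC subrK y1 andbT; apply: le_trans fy.
  by rewrite E2 -intrB ler_int ltW.
apply: (@le_trans _ _ (\esum_(l in [set: 'rV[int]_d])
    (((j%:Z, l) \in seq_fset tt (level j))%:R * (cube_height (j%:Z, l) * chi p (j%:Z, l) x))%:E)%E);
  last by apply: ereal_sup_ubound; exists j%:Z.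
apply: esum_ge; exists [set k]; first by split.
by rewrite fsbig_set1 seq_fsetE mem_level eqxx cube_heightE kc kt mulr1.
Qed.

End DyadicCubes.

Lemma Lnorm_le_scale (R : realType) d (T : measurableType d)
    (mu : {measure set T -> \bar R}) (p k : R) (f g : T -> R) : 0 < p -> 0 < k ->
  (forall t, 0 <= f t) -> (forall t, f t <= k * g t) ->
  (Lnorm mu p%:E (EFin \o f) <= k%:E * Lnorm mu p%:E (EFin \o g))%E.
Proof.
move=> p0 k0 f0 fg.
have g0 t : 0 <= g t by rewrite -(pmulr_rge0 _ k0) (le_trans (f0 t)).
have [_ Pm _ Pk] := integral_superlinear mu.
have E (h : T -> R) : (forall t, 0 <= h t) ->
    Lnorm mu p%:E (EFin \o h) = ((\int[mu]_t (h t `^ p)%:E) `^ p^-1)%E.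
  move=> h0; rewrite unlock; congr (_ `^ _)%E; apply: eq_integral => t _ /=.
  by rewrite ger0_norm.
have kp : 0 < k `^ (- p) by exact: powR_gt0.
have int_le : (\int[mu]_t (f t `^ p)%:E <= (k `^ p)%:E * \int[mu]_t (g t `^ p)%:E)%E.
  rewrite -lee_pdivrMl ?powR_gt0// -powRN.
  have fp t : 0 <= f t `^ p by exact: powR_ge0.
  apply: (le_trans (Pk _ _ kp fp)); apply: Pm => t; first by rewrite mulr_ge0 ?powR_ge0.
  apply: (@le_trans _ _ (k `^ (- p) * (k * g t) `^ p)).
    rewrite ler_wpM2l ?powR_ge0// ge0_ler_powR ?nnegrE ?(ltW p0)//.
    by rewrite mulr_ge0 ?(ltW k0).
  rewrite powRM ?(ltW k0)// mulrA -powRD ?addNr ?powRr0 ?mul1r//.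
  by rewrite (gt_eqF k0) implybT.
have I0 (h : T -> R) : (0 <= \int[mu]_t (h t `^ p)%:E)%E.
  by apply: integral_ge0 => t _; rewrite lee_fin powR_ge0.
have inI (x : \bar R) : (0 <= x)%E -> x \in `[0%E, +oo%E].
  by move=> x0; rewrite in_itv/= x0 leey.
have pi0 : 0 <= p^-1 by rewrite invr_ge0 ltW.
rewrite !E//; apply: (le_trans (gt0_ler_poweR pi0 _ _ int_le)).
- exact: inI.
- by apply: inI; rewrite mule_ge0// lee_fin powR_ge0.
- by rewrite poweRM ?lee_fin ?powR_ge0// poweR_EFin -powRrM mulfV ?gt_eqF// powRr1 ?(ltW k0).
Qed.

Section EndpointTriebel.
Variables (R : realType) (d : nat) (c : scalars) (r : R) (E : finType).
Variables (psi : E -> distr R d c) (X : fspace R d c).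
Hypothesis HX : function_space r X.
Hypothesis UX : unconditional_basis r psi X.
Local Notation wsum := (wsum r psi).

Lemma cube_wavelet_norm p (e0 : E) (F : {fset nabla d}) :
  wavelet_norm TriebelLizorkin p +oo%E (coeffs_on (single c e0 (@cube_height R d p)) F)
  = Lnorm (@leb R d) p%:E (fun t => cube_sup p F (rvec t)).
Proof.
rewrite /wavelet_norm; congr (Lnorm _ _); apply/funext => t.
congr ereal_sup; congr (_ @` _); apply/funext => j; apply: eq_esum => k _.
rewrite /coeffs_on; case: ifP => _; last by rewrite vmod0 !mul0r.
by rewrite vmod_single mul1r ger0_norm// cube_height_ge0.
Qed.

(** All the dyadic cubes of the unit cube, each with a coefficient of height one:
    every scale alone has the norm of the indicator of the unit cube, up to
    constants, and so have all the scales together, since only the supremum over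
    scales counts. *)
Lemma triebel_infty p : 1 <= p ->
  wavelet_characterization r psi TriebelLizorkin p +oo%E X ->
  assumption2 r psi X -> forall e : E, False.
Proof.
move=> p1 [A A0 HA] A2 e0.
have p0 : 0 < p by exact: lt_le_trans p1.
pose b := single c e0 (@cube_height R d p).
pose lev (j : nat) : {fset nabla d} := seq_fset tt (level d j).
have wX F : fdom X (wsum b F) by exact: (wsum_dom HX (atom_dom UX)).
have two0 : (0 : R) < 2 ^+ d by rewrite exprn_gt0.
(* All the functions [cube_sup F] lie between 0 and 2 ^ d times the indicator of
   the unit cube, and those of full levels lie above that indicator. *)
have compare F j : (wavelet_norm TriebelLizorkin p +oo%E (coeffs_on b F) <=
    (2 ^+ d)%:E * wavelet_norm TriebelLizorkin p +oo%E (coeffs_on b (lev j)))%E.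
  rewrite !cube_wavelet_norm.
  have cs_ge0 (G : {fset nabla d}) (x : 'rV[R]_d) : (0 <= cube_sup p G x)%E.
    apply: (@le_trans _ _ (\esum_(k in [set: 'rV[int]_d])
      (((0, k) \in G)%:R * (cube_height p (0, k) * chi p (0, k) x))%:E)%E).
      by apply: esum_ge0 => k _; rewrite lee_fin !mulr_ge0 ?cube_height_ge0 ?chi_ge0.
    by apply: ereal_sup_ubound; exists 0.
  have fin (G : {fset nabla d}) (x : 'rV[R]_d) : cube_sup p G x = (fine (cube_sup p G x))%:E.
    rewrite fineK// ge0_fin_numE//.
    by apply: (le_lt_trans (cube_sup_le p G x)); rewrite ltry.
  have toL (G : {fset nabla d}) : (fun t => cube_sup p G (rvec t)) = EFin \o (fun t => fine (cube_sup p G (rvec t))).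
    by apply/funext => t; rewrite /= -fin.
  rewrite !toL; apply: Lnorm_le_scale => // t; first by rewrite fine_ge0.
  rewrite -lee_fin EFinM -!fin; apply: (le_trans (cube_sup_le p F _)).
  by rewrite EFinM lee_pmul2l// cube_sup_ge.
pose n0 := fnorm X (wsum b (lev 0)).
have n0_gt0 : 0 < n0.
  have [B B0 HB] := coef_bounded HX UX.
  have l0 : (0, 0) \in lev 0.
    by rewrite seq_fsetE mem_level eqxx; apply/andP; split=> //=; apply/forallP => i; rewrite mxE.
  have := HB _ _ (wX (lev 0)) (expansion_wsum psi HX b (lev 0)) (0, 0).
  rewrite /coeffs_on l0 vmod_single -/n0 lt_neqAle (fnorm_ge0 HX)// andbT.
  apply: contraTneq => <-; rewrite mulr0 -ltNge normr_gt0.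
  move: l0; rewrite seq_fsetE mem_level => /andP[_ cu]; rewrite /cube_height cu.
  by rewrite gt_eqF// powR_gt0.
have up F : fnorm X (wsum b F) <= A * (2 ^+ d * (A * n0)).
  have [_] := HA _ _ (wX F) (expansion_wsum psi HX b F).
  have [le0 _] := HA _ _ (wX (lev 0)) (expansion_wsum psi HX b (lev 0)).
  rewrite -lee_fin => /le_trans; apply; rewrite EFinM lee_pmul2l//.
  apply: (le_trans (compare F 0)); rewrite [leRHS]EFinM lee_pmul2l//.
have lo j : n0 <= A * (2 ^+ d * (A * fnorm X (wsum b (lev j)))).
  have [_] := HA _ _ (wX (lev 0)) (expansion_wsum psi HX b (lev 0)).
  have [lej _] := HA _ _ (wX (lev j)) (expansion_wsum psi HX b (lev j)).
  rewrite -lee_fin => /le_trans; apply; rewrite EFinM lee_pmul2l//.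
  apply: (le_trans (compare (lev 0) j)); rewrite [leRHS]EFinM lee_pmul2l//.
pose C : R := A * 2 ^+ d * A; have C0 : 0 < C by rewrite !mulr_gt0.
apply: (@no_bounded_divergent _ _ _ _ _ psi X HX UX b
  (fun n => seq_fset tt (flatten [seq level d j | j <- iota 0 n]))
  (A * (2 ^+ d * (A * n0))) (n0 / C)) => //.
- exact: divr_gt0.
- move=> lam b0; exists (absz lam.1).+1 => n Nn; rewrite seq_fsetE.
  apply/flattenP; exists (level d (absz lam.1)).
    by apply/mapP; exists (absz lam.1) => //; rewrite mem_iota.
  rewrite mem_level; have cu : in_unit_cube lam.
    apply: contra_notT b0 => /negbTE cu; apply: vmod_eq0.
    by rewrite vmod_single /cube_height cu normr0.
  by rewrite cu andbT; move: cu => /andP[/gez0_abs ->].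
- move=> F; pose j := (\max_(mu <- enum_fset F) absz mu.1).+1.
  exists (lev j); split; last first.
    by rewrite ler_pdivrMr// mulrC /C -!mulrA.
  apply/fdisjointP => lam lF; rewrite seq_fsetE mem_level; apply/negP => /andP[/eqP lj _].
  have := @leq_bigmax_seq _ (enum_fset F) xpredT (fun mu => absz mu.1) _ lF isT.
  by rewrite lj absz_nat /j ltnn.
Qed.

End EndpointTriebel.

(** * Limits *)

Section Limits.
Variable R : realType.

Lemma limn_esup_cvg0 (x : nat -> nat -> R) : (forall L n, 0 <= x L n) ->
  (forall eps, 0 < eps -> exists L0, forall L, (L0 <= L)%N ->
     exists N, forall n, (N <= n)%N -> x L n <= eps) ->
  (fun L => limn_esup (fun n => (x L n)%:E)) @ \oo --> (0 : \bar R).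
Proof.
move=> x0 H.
have ge0 L : (0 <= limn_esup (fun n => (x L n)%:E))%E.
  apply: limf_esup_ge0 => [|n]; last by rewrite lee_fin.
  by move=> [N _ HN]; exact: (HN N (leqnn N)).
have le eps : 0 < eps -> exists L0, forall L, (L0 <= L)%N ->
    (limn_esup (fun n => (x L n)%:E) <= eps%:E)%E.
  move=> /H[L0 HL]; exists L0 => L /HL[N HN].
  rewrite /limn_esup limf_esupE; apply: (@le_trans _ _
    (ereal_sup ((fun n => (x L n)%:E) @` [set n | (N <= n)%N]))).
    by apply: ereal_inf_lbound; exists [set n | (N <= n)%N] => //; exists N.
  by apply: ge_ereal_sup => _ [n Nn <-]; rewrite lee_fin; exact: HN.
apply/fine_cvgP; split.
  have [L0 HL] := le 1 ltr01; exists L0 => // L /HL L1.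
  by rewrite ge0_fin_numE// (le_lt_trans L1)// ltry.
apply/cvgnP => eps /le[L0 HL]; exists L0 => L /HL Le.
rewrite subr0 /= ger0_norm ?fine_ge0//.
by case: limn_esup (ge0 L) Le => [y| |]//=; rewrite ?lee_fin.
Qed.

Lemma cvgn_sum (I : Type) (s : seq I) (x : I -> nat -> R) (l : I -> R) :
  (forall i, x i @ \oo --> l i) ->
  (fun n => \sum_(i <- s) x i n) @ \oo --> \sum_(i <- s) l i.
Proof.
move=> xl; elim: s => [|i s IH].
  rewrite big_nil (_ : (fun n => _) = cst 0); first exact: cvg_cst.
  by apply/funext => n; rewrite big_nil.
rewrite big_cons (_ : (fun n => _) = x i \+ (fun n => \sum_(i <- s) x i n)).
  exact: cvgD.
by apply/funext => n; rewrite big_cons.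
Qed.

Lemma cvg_powR (x : nat -> R) (l tau : R) : 0 < tau -> (forall n, 0 <= x n) ->
  x @ \oo --> l -> (fun n => x n `^ tau) @ \oo --> l `^ tau.
Proof.
move=> t0 x0 xl; have l0 : 0 <= l by apply: (cvgr_to_ge xl); exists 0.
have [lE|ln0] := eqVneq l 0; last first.
  have lp : 0 < l by rewrite lt_neqAle eq_sym ln0.
  have ld : derivable (fun a : R => a `^ tau) l 1.
    by apply: derivable_powR; rewrite in_itv/= lp.
  have lc : {for l, continuous (fun a : R => a `^ tau)}.
    by apply: differentiable_continuous; exact/derivable1_diffP.
  exact: (continuous_cvg _ lc xl).
rewrite lE powR0 ?gt_eqF//; apply/cvgnP => eps e0.
have [N HN] := (cvgnP x l).1 xl (eps `^ tau^-1) (powR_gt0 _ e0).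
exists N => n /HN; rewrite lE !subr0 !ger0_norm ?powR_ge0// => xe.
apply: (@le_trans _ _ ((eps `^ tau^-1) `^ tau)).
  by rewrite ge0_ler_powR ?nnegrE ?powR_ge0 ?(ltW t0).
by rewrite -powRrM mulVf ?gt_eqF// powRr1// ltW.
Qed.

Lemma sum_powR_limit (N : nat) (x : nat -> nat -> R) (l : nat -> R) (tau B : R) : 0 < tau ->
  (forall i n, 0 <= x i n) ->
  (forall i, (i < N)%N -> x i @ \oo --> l i) ->
  (exists M, forall n, (M <= n)%N -> \sum_(i < N) x i n `^ tau <= B) ->
  \sum_(i < N) l i `^ tau <= B.
Proof.
move=> t0 x0 xl [M HM].
have cv : (fun n => \sum_(i < N) x i n `^ tau) @ \oo --> \sum_(i < N) l i `^ tau.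
  by apply: cvgn_sum => i; apply: cvg_powR => //; exact: xl.
by apply: (cvgr_to_le cv); exists M.
Qed.

End Limits.

(** * Profiles *)

Section Profiles.
Variables (R : realType) (d : nat) (c : scalars) (r : R) (E : finType).
Variables (psi : E -> distr R d c) (X : fspace R d c).
Hypothesis HX : function_space r X.
Hypothesis UX : unconditional_basis r psi X.
Local Notation K := (Defs.scalar R c).
Local Notation coeffs := (nabla d -> E -> K).
Local Notation wsum := (wsum r psi).
Local Notation wterm := (wterm r psi).

Variables (D tau C1 : R).
Hypothesis HD : unconditional_const r psi X D.
Hypothesis tau0 : 0 < tau.
Hypothesis C10 : 0 <= C1.
Hypothesis HC1 : lower_estimate r psi X tau C1.

Variables (u : nat -> distr R d c) (B : R).
Hypothesis uX : forall n, fdom X (u n).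
Hypothesis uB : forall n, fnorm X (u n) <= B.
Variables (b : nat -> coeffs) (nu : nat -> nat -> nabla d).
Hypothesis ub : forall n, expansion r psi X (u n) (b n).
Hypothesis nu_inj : forall n, injective (nu n).
Variable dm : nat -> E -> K.
Hypothesis dm_lim : forall m e,
  (fun n => modulus (b n (nu n m) e - dm m e)) @ \oo --> (0 : R).

(** The position of the [m]-th largest wavelet, as a function of [n]. *)
Definition track (m n : nat) : nabla d := nu n m.
Hypothesis track_dichotomy : forall i m,
  orthogonal_indices R (track i) (track m) \/ merged R (track i) (track m).

Lemma root_exists m : exists i, `[< merged R (track i) (track m) >].
Proof. by exists m; apply/asboolP; exact: merged_refl. Qed.

(** Merging is an equivalence relation; its classes are represented by their
    least elements. *)
Definition root m := ex_minn (root_exists m).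

Lemma root_merged m : merged R (track (root m)) (track m).
Proof. by rewrite /root; case: ex_minnP => i /asboolP. Qed.

Lemma root_min i m : merged R (track i) (track m) -> (root m <= i)%N.
Proof. by rewrite /root; case: ex_minnP => k _ H /asboolP/H. Qed.

Lemma root_le m : (root m <= m)%N.
Proof. by apply: root_min; exact: merged_refl. Qed.

Lemma root_root m : root (root m) = root m.
Proof.
apply/eqP; rewrite eqn_leq root_le/=; apply: root_min.
exact: merged_trans (root_merged _) (root_merged _).
Qed.

Lemma roots_orthogonal k l : root k = k -> root l = l -> k <> l ->
  orthogonal_indices R (track k) (track l).
Proof.
move=> rk rl kl; have [//|kml] := track_dichotomy k l.
case: kl; apply/eqP; rewrite eqn_leq -{1}rk -{2}rl.
by rewrite !root_min//; exact: merged_sym.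
Qed.

Lemma placement_exists m : exists jyN : (int * 'rV[R]_d) * nat, forall n, (jyN.2 <= n)%N ->
  (track m n).1 = (track (root m) n).1 + jyN.1.1 /\
  intvec R (track m n).2 = jyN.1.2 + 2 ^ jyN.1.1 *: intvec R (track (root m) n).2.
Proof.
have [j [y [N H]]] := merged_sym (root_merged m).
exists ((j, y), N) => n /= /H[<- <-].
by rewrite [_ + (_ - _)]addrC !subrK.
Qed.

Definition placement m := (sval (cid (placement_exists m))).1.

(** The limit of the [m]-th wavelet term, seen from the track of its root. Its
    space index is dyadic but in general not integral, so it need not be a
    wavelet of the basis. *)
Definition piece m : distr R d c :=
  \sum_(e : E) dm m e *: place r (placement m).1 (placement m).2 (psi e).

Lemma piece_dom m : fdom X (piece m).
Proof.
apply: (fdom_sum HX) => e _; apply: (fdomZ HX).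
exact: (place_norm HX _ _ (psi_dom UX e)).1.
Qed.

Lemma piece_rescale m : exists N, forall n, (N <= n)%N ->
  rescale r (piece m) (track (root m) n) = wterm (fun _ => dm m) (track m n).
Proof.
exists (sval (cid (placement_exists m))).2 => n Nn.
have := svalP (cid (placement_exists m)) n Nn; rewrite -/(placement m) => -[jE yE].
rewrite rescaleE place_sum; apply: eq_bigr => e _.
by rewrite placeZ place_place rescaleE jE yE.
Qed.

(** The error made when the [m]-th wavelet term is replaced by its limit. *)
Definition defect m n : distr R d c :=
  rescale r (piece m) (track (root m) n) - wterm (b n) (track m n).

Lemma wterm_dom_X (b' : coeffs) lam : fdom X (wterm b' lam).
Proof. exact: (wterm_dom HX (atom_dom UX)). Qed.

Lemma defect_dom m n : fdom X (defect m n).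
Proof.
apply: (fdomB HX); last exact: wterm_dom_X.
by apply: (rescale_dom HX); exact: piece_dom.
Qed.

Lemma defect_small m eps : 0 < eps -> exists N, forall n, (N <= n)%N ->
  fnorm X (defect m n) <= eps.
Proof.
move=> e0; have [N HN] := piece_rescale m.
have cv : (fun n => \sum_(e : E) modulus (b n (nu n m) e - dm m e) * fnorm X (psi e))
    @ \oo --> \sum_(e : E) 0 * fnorm X (psi e).
  apply: (@cvgn_sum R _ _ (fun e n => modulus (b n (nu n m) e - dm m e) * fnorm X (psi e))) => e.
  rewrite (_ : (fun n => _) = (fun n => modulus (b n (nu n m) e - dm m e)) \* cst (fnorm X (psi e)))//.
  by apply: cvgM; [exact: dm_lim|exact: cvg_cst].
rewrite big1 in cv => [|e _]; last by rewrite mul0r.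
have [N' HN'] := (cvgnP _ _).1 cv _ e0.
exists (maxn N N') => n; rewrite geq_max => /andP[Nn /HN'].
rewrite subr0 => /(le_trans (ler_norm _)); apply: le_trans.
rewrite /defect HN// -(fnormN HX) ?opprB.
  have -> : wterm (b n) (track m n) - wterm (fun _ => dm m) (track m n) =
      wterm (b n - (fun _ => dm m)) (track m n).
    rewrite /Defs.wterm -sumrB; apply: eq_bigr => e _; exact/esym/scalerBl.
  exact: (wterm_norm_le HX UX).
by apply: (fdomB HX); exact: wterm_dom_X.
Qed.

Lemma defects_small M eps : 0 < eps -> exists N, forall n, (N <= n)%N ->
  forall P : pred nat, fnorm X (\sum_(0 <= m < M | P m) defect m n) <= eps.
Proof.
move=> e0; have e1 : 0 < eps / M.+1%:R by rewrite divr_gt0.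
have /choice[N HN] : forall m, exists N, forall n, (N <= n)%N ->
    fnorm X (defect m n) <= eps / M.+1%:R by move=> m; exact: defect_small.
exists (\max_(m < M) N m) => n Nn P.
apply: (le_trans (fnorm_sum HX _ _)) => [m _|]; first exact: defect_dom.
apply: (@le_trans _ _ (\sum_(0 <= m < M) eps / M.+1%:R)).
  rewrite big_mkcond big_nat [leRHS]big_nat; apply: ler_sum => m /= mM.
  case: ifP => _; last exact: ltW.
  apply: HN; apply: leq_trans Nn.
  exact: (@leq_bigmax _ (fun m : 'I_M => N m) (Ordinal mM)).
rewrite sumr_const_nat subn0 -[leLHS]mulr_natl mulrCA ler_piMr ?(ltW e0)//.
by rewrite ler_pdivrMr// mul1r ler_nat.
Qed.

Lemma defect_sum M (P : pred nat) l n : (forall m, (m < M)%N -> P m -> root m = l) ->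
  \sum_(0 <= m < M | P m) defect m n =
  rescale r (\sum_(0 <= m < M | P m) piece m) (track l n) -
  \sum_(0 <= m < M | P m) wterm (b n) (track m n).
Proof.
move=> PL; rewrite rescaleE place_sum -sumrB big_nat_cond [RHS]big_nat_cond.
by apply: eq_bigr => m /andP[mM Pm]; rewrite /defect (PL m).
Qed.

(** Pieces with a common root are, up to vanishing errors, rescaled wavelet terms,
    and rescaling preserves the norm. *)
Lemma pieces_norm_cvg M (P : pred nat) l : (forall m, (m < M)%N -> P m -> root m = l) ->
  (fun n => fnorm X (\sum_(0 <= m < M | P m) wterm (b n) (track m n))) @ \oo -->
    fnorm X (\sum_(0 <= m < M | P m) piece m).
Proof.
move=> PL; apply/cvgnP => eps /(defects_small M)[N HN]; exists N => n /HN/(_ P).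
rewrite (defect_sum n PL).
have pX : fdom X (\sum_(0 <= m < M | P m) piece m).
  by apply: (fdom_sum HX) => m _; exact: piece_dom.
have wX : fdom X (\sum_(0 <= m < M | P m) wterm (b n) (track m n)).
  by apply: (fdom_sum HX) => m _; exact: wterm_dom_X.
rewrite -(rescale_norm HX (track l n) pX).
have rX := rescale_dom HX (track l n) pX.
move: rX wX; set f := rescale _ _ _; set g := \sum_(0 <= m < M | P m) _ => fX gX fg.
rewrite ler_norml; apply/andP; split.
  rewrite lerNl opprB lerBlDl; apply: (le_trans (fnorm_sub_le HX fX gX)).
  by rewrite lerD2l.
rewrite lerBlDl; apply: (le_trans (fnorm_sub_le HX gX fX)).
by rewrite lerD2l (fnorm_distC HX).
Qed.

(** The lower estimate survives in the limit although the pieces are not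
    wavelets: each class of pieces is a limit of rescaled wavelet sums. *)
Lemma pieces_lower_estimate M N (col rt : nat -> nat) :
  (forall m, (m < M)%N -> (col m < N)%N -> root m = rt (col m)) ->
  \sum_(i < N) fnorm X (\sum_(0 <= m < M | col m == i) piece m) `^ tau
    <= C1 * (D * B) `^ tau.
Proof.
move=> col_rt.
apply: (@sum_powR_limit R N
  (fun i n => fnorm X (\sum_(0 <= m < M | col m == i) wterm (b n) (track m n)))
  (fun i => fnorm X (\sum_(0 <= m < M | col m == i) piece m))) => //.
- move=> i n; apply: (fnorm_ge0 HX); apply: (fdom_sum HX) => m _; exact: wterm_dom_X.
- move=> i iN; apply: (@pieces_norm_cvg _ _ (rt i)) => m mM /eqP ci.
  by rewrite -ci; apply: col_rt => //; rewrite ci.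
- exists 0 => n _; apply: (le_trans (HC1 (b n) M N col (@nu_inj n))).
  rewrite ler_wpM2l//.
  have w0 : 0 <= fnorm X (\sum_(0 <= m < M) wterm (b n) (nu n m)).
    by apply: (fnorm_ge0 HX); apply: (fdom_sum HX) => m _; exact: wterm_dom_X.
  have wD : fnorm X (\sum_(0 <= m < M) wterm (b n) (nu n m)) <= D * B.
    rewrite -wsum_initial//; apply: (le_trans (block_le HX (atom_dom UX) _ HD (uX n) (ub n))).
    by rewrite ler_wpM2l// HD.1.
  by rewrite ge0_ler_powR ?nnegrE ?(ltW tau0)// (le_trans w0).
Qed.

Definition partial l M : distr R d c := \sum_(0 <= m < M | root m == l) piece m.

Lemma partial_dom l M : fdom X (partial l M).
Proof. by apply: (fdom_sum HX) => m _; exact: piece_dom. Qed.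

Lemma partialB l M M' : (M <= M')%N -> partial l M' - partial l M =
  \sum_(M <= m < M' | root m == l) piece m.
Proof.
move=> MM; rewrite /partial (big_cat_nat (leq0n M) MM)/=.
by rewrite addrAC subrr add0r.
Qed.

(** If the partial sums were not Cauchy, consecutive blocks of norm at least
    [eps] would contradict the lower estimate once there are enough of them. *)
Lemma partial_cauchy l eps : 0 < eps -> exists M0 : nat, forall M M',
  (M0 <= M)%N -> (M0 <= M')%N -> fnorm X (partial l M - partial l M') < eps.
Proof.
move=> e0; apply: contrapT => nC.
have e20 : 0 < eps / 2 by rewrite divr_gt0.
have /choice[g Hg] : forall M0, exists M, (M0 < M)%N /\
    eps / 2 <= fnorm X (partial l M - partial l M0).
  move=> M0; apply: contrapT => /forallNP nM; apply: nC; exists M0 => M M' MM MM'.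
  have small m : (M0 <= m)%N -> fnorm X (partial l m - partial l M0) < eps / 2.
    rewrite leq_eqVlt => /predU1P[<-|M0m]; first by rewrite subrr (fnorm0 HX).
    by rewrite ltNge; apply/negP => em; apply: (nM m).
  have -> : partial l M - partial l M' =
      (partial l M - partial l M0) - (partial l M' - partial l M0).
    by rewrite opprB addrA subrK.
  rewrite (splitr eps); apply: (le_lt_trans _ (ltrD (small _ MM) (small _ MM'))).
  by apply: (fnormB HX); apply: (fdomB HX); exact: partial_dom.
pose t i := iter i g 0.
have ti : increasing t by apply: increasing_step => i; exact: (Hg _).1.
have tmono j k : (j <= k)%N -> (t j <= t k)%N.
  by rewrite leq_eqVlt => /predU1P[->//|/ti/ltnW].
have t_block m : exists i, (t i <= m < t i.+1)%N.
  have ex : exists i, (m < t i.+1)%N by exists m; exact: (increasing_ge ti m.+1).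
  exists (ex_minn ex); case: ex_minnP => -[|i] mi H; rewrite mi andbT//.
  by rewrite leqNgt; apply/negP => /H; rewrite ltnn.
have /choice[q Hq] := t_block.
have t_uniq i m : (t i <= m < t i.+1)%N -> q m = i.
  move=> /andP[im mi]; have /andP[qm mq] := Hq m.
  apply/eqP; rewrite eqn_leq; apply/andP; split; rewrite leqNgt; apply/negP => /tmono.
    by move=> /leq_trans/(_ qm); rewrite leqNgt mi.
  by move=> /leq_trans/(_ im); rewrite leqNgt mq.
have many N : N%:R * (eps / 2) `^ tau <= C1 * (D * B) `^ tau.
  pose col m := if root m == l then q m else N.
  apply: (le_trans _ (@pieces_lower_estimate (t N) N col (fun _ => l) _)); last first.
    by move=> m _; rewrite /col; case: eqP => // _; rewrite ltnn.
  rewrite mulr_natl -[X in _ *+ X]card_ord -sumr_const.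
  apply: ler_sum => i _; rewrite ge0_ler_powR ?nnegrE ?(ltW tau0) ?(ltW e20)//.
    by apply: (fnorm_ge0 HX); apply: (fdom_sum HX) => m _; exact: piece_dom.
  apply: (le_trans (Hg (t i)).2); rewrite le_eqVlt; apply/orP; left; apply/eqP.
  have tS : (t i <= t i.+1)%N by exact: tmono (leqnSn i).
  congr (fnorm X _); rewrite -[g (t i)]/(t i.+1) (partialB _ tS).
  have tN : (t i.+1 <= t N)%N by exact: tmono (ltn_ord i).
  have t0 : (t i <= t N)%N by exact: leq_trans tS tN.
  rewrite [RHS](big_cat_nat (leq0n (t i)) t0)/= [X in _ = X + _]big_nat_cond [X in _ = X + _]big1 ?add0r => [|m].
    rewrite [RHS](big_cat_nat tS tN)/=.
    rewrite [X in _ = _ + X]big_nat_cond [X in _ = _ + X]big1 ?addr0 => [|m].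
      rewrite big_nat_cond [RHS]big_nat_cond; apply: eq_bigl => m.
      case: (boolP (t i <= m < t i.+1)%N) => //= im; rewrite /col (t_uniq _ _ im).
      by case: eqP => //= _; [rewrite eqxx|rewrite gtn_eqF].
    move=> /andP[/andP[im mN]]; rewrite /col; case: ifP => _ /eqP.
      by move=> qi; have := Hq m; rewrite qi ltnNge im andbF.
    by move=> Ni; have := ltn_ord i; rewrite -Ni ltnn.
  move=> /andP[/andP[_ mi]]; rewrite /col; case: ifP => _ /eqP.
    by move=> qi; have := Hq m; rewrite qi leqNgt mi.
  by move=> Ni; have := ltn_ord i; rewrite -Ni ltnn.
have et : 0 < (eps / 2) `^ tau by rewrite powR_gt0.
have := many (Num.truncn (C1 * (D * B) `^ tau / (eps / 2) `^ tau)).+1.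
by rewrite -ler_pdivlMr// leNgt truncnS_gt.
Qed.

Lemma partial_cvg l : complete_space X ->
  exists2 phi, fdom X phi & (fun M => fnorm X (partial l M - phi)) @ \oo --> (0 : R).
Proof. by apply; [exact: partial_dom|exact: partial_cauchy]. Qed.

Variable phi : nat -> distr R d c.
Hypothesis phiX : forall l, fdom X (phi l).
Hypothesis phi_lim : forall l,
  (fun M => fnorm X (partial l M - phi l)) @ \oo --> (0 : R).

Lemma partial_norm_cvg l : fnorm X (partial l M) @[M --> \oo] --> fnorm X (phi l).
Proof.
apply/cvgnP => eps e0; have [N HN] := (cvgnP _ _).1 (phi_lim l) _ e0.
exists N => M /HN; rewrite subr0 => /(le_trans (ler_norm _)).
have [pX lX] := (partial_dom l M, phiX l) => Mle.
rewrite ler_norml; apply/andP; split.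
  rewrite lerNl opprB lerBlDl; apply: (le_trans (fnorm_sub_le HX lX pX)).
  by rewrite lerD2l (fnorm_distC HX).
by rewrite lerBlDl; apply: (le_trans (fnorm_sub_le HX pX lX)); rewrite lerD2l.
Qed.

Lemma profiles_stable L : \sum_(l < L) fnorm X (phi l) `^ tau <= C1 * (D * B) `^ tau.
Proof.
apply: (@sum_powR_limit R L (fun l M => fnorm X (partial l M))
  (fun l => fnorm X (phi l))) => //.
- by move=> l M; apply: (fnorm_ge0 HX); exact: partial_dom.
- by move=> l _; exact: partial_norm_cvg.
- by exists 0 => M _; apply: (pieces_lower_estimate (rt := id)).
Qed.

(** Indices [l] that are not roots carry a null profile; their scales are sent
    to infinity faster than all tracks, and at different rates. *)
Definition profile_index (l n : nat) : nabla d :=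
  if root l == l then track l n
  else ((l.+1 * n + \max_(i < n.+1) absz (track i n).1)%N%:Z, 0).

Lemma profile_index_orthogonal k l : k <> l ->
  orthogonal_indices R (profile_index k) (profile_index l).
Proof.
move=> kl; clear tau0 C10; have [rk|nrk] := eqVneq (root k) k; have [rl|nrl] := eqVneq (root l) l.
- rewrite (_ : profile_index k = track k) 1?(_ : profile_index l = track l).
  + exact: roots_orthogonal.
  + by apply/funext => n; rewrite /profile_index rl eqxx.
  + by apply/funext => n; rewrite /profile_index rk eqxx.
all: left; apply/cvgn_pinftyP => A; exists (maxn (k + l) (Num.truncn A).+1) => n.
all: rewrite geq_max => /andP[kln An].
all: have {An}An : A <= n%:R by apply: (le_trans (ltW (truncnS_gt A))); rewrite ler_nat.
all: apply: (le_trans An); rewrite -intrB -intr_norm -[n%:R]/(n%:Z%:~R) ler_int.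
all: have mx i : (i <= n)%N -> (absz (track i n).1 <= \max_(i < n.+1) absz (track i n).1)%N
  by move=> iN; exact: (@leq_bigmax _ (fun i : 'I_n.+1 => absz (track i n).1) (Ordinal (iN : (i < n.+1)%N))).
- rewrite /profile_index rk eqxx (negbTE nrl)/=.
  have := mx k (leq_trans (leq_addr _ _) kln); set S := \max_(i < n.+1) _.
  have h : (n <= l.+1 * n)%N by exact: leq_pmull.
  by move: (track k n).1 (l.+1 * n)%N h => a w h; lia.
- rewrite /profile_index rl eqxx (negbTE nrk)/=.
  have := mx l (leq_trans (leq_addl _ _) kln); set S := \max_(i < n.+1) _.
  have h : (n <= k.+1 * n)%N by exact: leq_pmull.
  by move: (track l n).1 (k.+1 * n)%N h => a w h; lia.
- rewrite /profile_index (negbTE nrk) (negbTE nrl)/=; set S := \max_(i < n.+1) _.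
  have gap i j : (i < j)%N -> (i.+1 * n + n <= j.+1 * n)%N.
    by move=> ij; rewrite addnC -mulSn leq_mul2r ltnS ij orbT.
  have [kl'|lk|//] := ltngtP k l; [have := gap _ _ kl'|have := gap _ _ lk];
    by move: (k.+1 * n)%N (l.+1 * n)%N => a w; lia.
Qed.

Lemma partial_nonroot l M : root l != l -> partial l M = 0.
Proof.
move=> nrl; rewrite /partial big1// => m /eqP ml; move: nrl.
by rewrite -ml root_root eqxx.
Qed.

Lemma phi_nonroot l : root l != l -> fnorm X (phi l) = 0.
Proof.
move=> /partial_nonroot p0.
apply/eqP; rewrite eq_le (fnorm_ge0 HX)// andbT.
have pl := @partial_norm_cvg l.
apply: (cvgr_to_le pl); exists 0 => // M _.
by rewrite /= p0 (fnorm0 HX).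
Qed.

Lemma profile_defect l M n :
  fnorm X (rescale r (phi l) (profile_index l n) - rescale r (partial l M) (track l n))
    <= fnorm X (partial l M - phi l).
Proof.
have [pX lX] := (partial_dom l M, phiX l).
have [rl|nrl] := eqVneq (root l) l.
  rewrite /profile_index rl eqxx -rescaleB.
  by rewrite (rescale_norm HX); [rewrite (fnorm_distC HX)|exact: (fdomB HX)].
rewrite partial_nonroot// rescale0 subr0.
by rewrite (rescale_norm HX)// phi_nonroot// (fnorm_ge0 HX)//; apply: (fdomB HX) => //; exact: (fdom0 HX).
Qed.

Section RemainderIn.
Variables (Y : fspace R d c) (DY : R).
Hypothesis HY : function_space r Y.
Hypothesis XY : embedded X Y.
Hypothesis UY : unconditional_basis r psi Y.
Hypothesis HDY : unconditional_const r psi Y DY.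

(** The remainder consists of the tail of the greedy sum, the terms whose class is
    not among the first [L] profiles, the replacement of coefficients by their
    limits, and the truncation of the profiles. *)
Lemma remainder_split L M n :
  remainder r u phi profile_index n L =
    (u n - \sum_(0 <= m < M) wterm (b n) (track m n))
    + \sum_(0 <= m < M | (L <= root m)%N) wterm (b n) (track m n)
    - \sum_(0 <= m < M | (root m < L)%N) defect m n
    - \sum_(l < L) (rescale r (phi l) (profile_index l n) - rescale r (partial l M) (track l n)).
Proof.
rewrite /remainder -addrA -opprD.
have -> : \sum_(l < L) (rescale r (phi l) (profile_index l n) - rescale r (partial l M) (track l n)) =
    \sum_(l < L) rescale r (phi l) (profile_index l n) -
    \sum_(0 <= m < M | (root m < L)%N) rescale r (piece m) (track (root m) n).
  rewrite sumrB; congr (_ - _).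
  rewrite (eq_bigr (fun l : 'I_L => \sum_(0 <= m < M | root m == l)
      rescale r (piece m) (track (root m) n))); last first.
    move=> l _; rewrite /partial rescaleE place_sum; apply: eq_bigr => m /eqP ->.
    by rewrite -rescaleE.
  rewrite (exchange_big_dep xpredT)//= [RHS]big_mkcond; apply: eq_bigr => m _.
  case: ltnP => mL.
    by rewrite (big_pred1 (Ordinal mL)).
  rewrite big_pred0// => l; apply/negbTE; apply: contraTneq mL => ->.
  by rewrite -ltnNge.
rewrite /defect sumrB.
have -> : \sum_(0 <= m < M) wterm (b n) (track m n) =
    \sum_(0 <= m < M | (L <= root m)%N) wterm (b n) (track m n) +
    \sum_(0 <= m < M | (root m < L)%N) wterm (b n) (track m n).
  rewrite (bigID (fun m => (L <= root m)%N))/=; congr (_ + _).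
  by apply: eq_bigl => m; rewrite ltnNge.
set S1 := \sum_(0 <= m < M | (L <= root m)%N) _.
set S2 := \sum_(0 <= m < M | (root m < L)%N) wterm _ _.
set S3 := \sum_(0 <= m < M | (root m < L)%N) _.
set S4 := \sum_(l < L) _.
rewrite [S3 - S2 + _]addrC addrA subrK opprB opprD !addrA.
by rewrite (addrAC _ (- S2)) !subrK.
Qed.

(** Since [root m <= m], the terms whose class is not among the first [L] profiles
    have rank at least [L]; by unconditionality in [Y] their sum is controlled by
    the greedy error at [L]. The other contributions vanish when [n] and then the
    truncation [M] tend to infinity, for fixed [L]. *)
Lemma remainder_small :
  (forall eps, 0 < eps -> exists M0, forall M n, (M0 <= M)%N ->
     fnorm Y (u n - \sum_(0 <= m < M) wterm (b n) (track m n)) <= eps) ->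
  forall eps, 0 < eps -> exists L0, forall L, (L0 <= L)%N -> exists N, forall n, (N <= n)%N ->
    fnorm Y (remainder r u phi profile_index n L) <= eps.
Proof.
move=> Herr eps e0; pose e4 := eps / 4; have e40 : 0 < e4 by rewrite divr_gt0.
have D1 : 0 < DY + 1 by rewrite ltr_wpDl// HDY.1.
have [A A0 HA] := embedded_const HX XY.
have YX f : fdom X f -> fdom Y f by case: XY => H _; exact: H.
have [L0 HL0] := Herr _ (divr_gt0 e40 D1); exists L0 => L LL.
have [M1 HM1] := Herr _ e40.
have eL : 0 < e4 / A / L.+1%:R by rewrite !divr_gt0.
have /choice[M2 HM2] : forall l, exists N : nat, forall M, (N <= M)%N ->
    fnorm X (partial l M - phi l) <= e4 / A / L.+1%:R.
  move=> l; have [N HN] := (cvgnP _ _).1 (phi_lim l) _ eL; exists N => M /HN.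
  by rewrite subr0; apply: le_trans; exact: ler_norm.
pose M := maxn M1 (\max_(l < L) M2 l).
have [N HN] := defects_small M (divr_gt0 e40 A0); exists N => n Nn.
have wX P M' : fdom X (\sum_(0 <= m < M' | P m) wterm (b n) (track m n)).
  by apply: (fdom_sum HX) => m _; exact: wterm_dom_X.
have dX P : fdom X (\sum_(0 <= m < M | P m) defect m n).
  by apply: (fdom_sum HX) => m _; exact: defect_dom.
have tX l : fdom X (rescale r (phi l) (profile_index l n) - rescale r (partial l M) (track l n)).
  by apply: (fdomB HX); apply: (rescale_dom HX) => //; exact: partial_dom.
have uwX : fdom X (u n - \sum_(0 <= m < M) wterm (b n) (track m n)) by exact: (fdomB HX).
have sX : fdom X (\sum_(l < L) (rescale r (phi l) (profile_index l n) -
    rescale r (partial l M) (track l n))) by exact: (fdom_sum HX).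
rewrite (remainder_split L M n).
have T1 : fnorm Y (u n - \sum_(0 <= m < M) wterm (b n) (track m n)) <= e4.
  by apply: HM1; exact: leq_maxl.
have T2 : fnorm Y (\sum_(0 <= m < M | (L <= root m)%N) wterm (b n) (track m n)) <= e4.
  rewrite -(wsum_initial _ _ (b n) M (fun m => (L <= root m)%N) (@nu_inj n)).
  have dis : [disjoint initial (nu n) M (fun m => (L <= root m)%N) &
      initial (nu n) L xpredT]%fset.
    apply: initial_disjoint => // m _ mL rL.
    by have := leq_trans rL (root_le m); rewrite leqNgt mL.
  apply: (le_trans (block_le_tail HY (atom_dom UY) HDY (YX _ (uX n))
    (embedded_expansion HX UX XY (uX n) (ub n)) dis)).
  rewrite wsum_initial//; apply: (le_trans (ler_wpM2l HDY.1 (HL0 L n LL))).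
  by rewrite mulrCA ler_piMr ?(ltW e40)// ler_pdivrMr// mul1r lerDl.
have T3 : fnorm Y (\sum_(0 <= m < M | (root m < L)%N) defect m n) <= e4.
  apply: (le_trans (HA _ (dX _))); rewrite -ler_pdivlMl// mulrC; exact: HN.
have T4 : fnorm Y (\sum_(l < L) (rescale r (phi l) (profile_index l n) -
    rescale r (partial l M) (track l n))) <= e4.
  apply: (le_trans (HA _ sX)); rewrite -ler_pdivlMl// mulrC.
  apply: (le_trans (fnorm_sum HX _ _)) => [l _|]; first exact: tX.
  apply: (@le_trans _ _ (\sum_(l < L) e4 / A / L.+1%:R)).
    apply: ler_sum => l _; apply: (le_trans (profile_defect _ _ _)); apply: HM2.
    by apply: leq_trans (leq_maxr _ _); exact: (@leq_bigmax _ (fun l : 'I_L => M2 l) l).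
  rewrite sumr_const card_ord -[leLHS]mulr_natl mulrCA.
  rewrite ler_piMr ?(divr_ge0 (ltW e40) (ltW A0))//.
  by rewrite ler_pdivrMr// mul1r ler_nat.
have -> : eps = e4 + e4 + e4 + e4 by rewrite /e4; field.
apply: (le_trans (fnormB HY _ _)); [|exact: YX|apply: lerD T4].
  by apply: YX; apply: (fdomB HX) => //; exact: (fdomD HX).
apply: (le_trans (fnormB HY _ _)); [|exact: YX|apply: lerD T3].
  by apply: YX; exact: (fdomD HX).
by apply: (le_trans (fnormD HY _ _)); [exact: YX|exact: YX|exact: lerD].
Qed.

End RemainderIn.
End Profiles.

(** * The decomposition *)

Section GoodSubsequence.
Variables (R : realType) (d : nat) (c : scalars) (r : R) (E : finType).
Variables (psi : E -> distr R d c) (X : fspace R d c).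
Hypothesis HX : function_space r X.
Hypothesis UX : unconditional_basis r psi X.
Local Notation K := (Defs.scalar R c).

Lemma extraction (u : nat -> distr R d c) (B : R) (b : nat -> nabla d -> E -> K)
    (nu : nat -> nat -> nabla d) :
  (forall n, fdom X (u n)) -> (forall n, fnorm X (u n) <= B) ->
  (forall n, expansion r psi X (u n) (b n)) ->
  exists2 s, increasing s &
    (exists dm : nat -> E -> K, forall m e,
      (fun n => modulus (b (s n) (nu (s n) m) e - dm m e)) @ \oo --> (0 : R)) /\
    (forall i m, orthogonal_indices R (fun n => nu (s n) i) (fun n => nu (s n) m) \/
      merged R (fun n => nu (s n) i) (fun n => nu (s n) m)).
Proof.
move=> uX uB ub; have [A A0 HA] := coef_bounded HX UX.
pose P (q : (nat * E) + (nat * nat)) (s : nat -> nat) : Prop := match q with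
  | inl me => exists l : K,
      (fun n => modulus (b (s n) (nu (s n) me.1) me.2 - l)) @ \oo --> (0 : R)
  | inr im => orthogonal_indices R (fun n => nu (s n) im.1) (fun n => nu (s n) im.2) \/
      merged R (fun n => nu (s n) im.1) (fun n => nu (s n) im.2)
  end.
have [||s si Ps] := @diagonal_extraction _ P.
- move=> [[m e]|[i m]] s si /=.
    have [t ti [l tl]] := @modulus_subseq R c (fun n => b (s n) (nu (s n) m) e) (A * B)
      (fun n => le_trans (modulus_le_vmod _ _)
        (le_trans (HA _ _ (uX _) (ub _) _) (ler_wpM2l A0 (uB _)))).
    by exists t => //; exists l.
  have [t ti H] := orthogonal_or_merged R (fun n => nu (s n) i) (fun n => nu (s n) m).
  by exists t.
- move=> [[m e]|[i m]] s s' /= Ps ss'.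
    have [l /cvgnP sl] := Ps; have [N [rho [rge sE]]] := ss'.
    exists l; apply/cvgnP => eps /sl[M HM]; exists (maxn N M) => n.
    rewrite geq_max => /andP[Nn Mn]; rewrite sE//.
    by apply: (HM (rho n)); exact: leq_trans (rge n).
  exact: (@orthogonal_or_merged_restriction R d (fun n => nu n i) (fun n => nu n m) s s' ss' Ps).
exists s => //; split=> [|i m]; last exact: (Ps (inr (i, m))).
have /choice[l Hl] : forall me : nat * E, exists l : K,
    (fun n => modulus (b (s n) (nu (s n) me.1) me.2 - l)) @ \oo --> (0 : R).
  by move=> me; exact: (Ps (inl me)).
by exists (fun m e => l (m, e)) => m e; exact: (Hl (m, e)).
Qed.

End GoodSubsequence.

Lemma lnorm_le (R : realType) (tau B : R) (x : nat -> R) : 0 < tau -> 0 <= B ->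
  (forall l, 0 <= x l) -> (forall L, \sum_(l < L) x l `^ tau <= B `^ tau) ->
  (lnorm tau%:E (fun l : nat => (x l)%:E) <= B%:E)%E.
Proof.
move=> t0 B0 x0 H; rewrite /lnorm.
have le : (\esum_(l in [set: nat]) ((x l)%:E `^ tau) <= (B `^ tau)%:E)%E.
  rewrite -nneseries_esumT => [|l]; last exact: poweR_ge0.
  apply: lime_le; first by apply: is_cvg_nneseries => l _ _; exact: poweR_ge0.
  exists 0 => // L _ /=; rewrite big_mkord.
  rewrite (eq_bigr (fun l : 'I_L => (x l `^ tau)%:E))// sumEFin lee_fin; exact: H.
have inI (y : \bar R) : (0 <= y)%E -> y \in `[0%E, +oo%E].
  by move=> y0; rewrite in_itv/= y0 leey.
have ti0 : 0 <= tau^-1 by rewrite invr_ge0 ltW.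
apply: (le_trans (gt0_ler_poweR ti0 _ _ le)).
- by apply: inI; apply: esum_ge0 => l _; exact: poweR_ge0.
- by apply: inI; rewrite lee_fin powR_ge0.
- by rewrite poweR_EFin -powRrM mulfV ?gt_eqF// powRr1.
Qed.

Theorem theorem1p2 (R : realType) (d : nat) (c : scalars) (fam : space_family)
    (s p : R) (a : \bar R) (r : R) (X : fspace R d c)
    (hd : (0 < d)%N) (hp : 1 <= p) (ha : (1 <= a)%E) (hr : r = d%:R / p - s)
    (hX : homogeneous_space fam s p a X) (hXr : function_space r X) :
  exists tau : \bar R, (1 <= tau)%E /\
  forall (E : finType) (psi : E -> distr R d c),
    (d = 1%N -> #|E| = 1%N) ->
    unconditional_basis r psi X ->
    wavelet_characterization r psi fam p a X ->
    assumption2 r psi X ->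
  exists C : R,
  forall (Y : fspace R d c) (Q : nat -> distr R d c -> distr R d c),
    function_space r Y ->
    embedded X Y ->
    unconditional_basis r psi Y ->
    nonlinear_projector r psi X Q ->
    assumption1 X Y Q ->
  forall u : nat -> distr R d c,
    (forall n, fdom X (u n)) ->
    (exists B, forall n, fnorm X (u n) <= B) ->
  exists (sigma : nat -> nat) (phi : nat -> distr R d c)
         (lam : nat -> nat -> nabla d),
    [/\ {homo sigma : m n / (m < n)%N} /\ (forall l, fdom X (phi l)),
        (fun L => limn_esup (fun n =>
           (fnorm Y (remainder r (u \o sigma) phi lam n L))%:E)) @ \oo
          --> (0 : \bar R),
        forall k l : nat, k <> l -> orthogonal_indices R (lam k) (lam l)
      & (lnorm tau (fun l : nat => (fnorm X (phi l))%:E)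
           <= (C * sup (range (fun n => fnorm X (u n))))%:E)%E].
Proof.
pose tau := if a is q%:E then Num.max p q else p.
have tau1 : 1 <= tau by rewrite /tau; case: (a) => [q| |] //; rewrite le_max hp.
have tau0 : 0 < tau by exact: lt_le_trans tau1.
exists tau%:E; split; first by rewrite lee_fin.
move=> E psi _ UX WX A2.
(* For [a = +oo] Assumption 2 forces [E] to be empty, and all wavelet sums vanish. *)
have [C1 C10 HC1] : exists2 C1, 0 <= C1 & lower_estimate r psi X tau C1.
  rewrite /tau; case: a ha WX {hX tau tau1 tau0} => [q| |] // hq WX.
    exact: (lower_estimate_finite hXr UX hp _ WX).
  exists 0 => //; apply: lower_estimate_empty => //; first exact: lt_le_trans hp.
  case: fam WX => WX; first exact: (besov_infty hXr UX hp WX A2).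
  exact: (triebel_infty hXr UX hp WX A2).
have [D HD] := unconditional_constP hXr (atom_dom UX) UX.
exists (C1 `^ tau^-1 * D) => Y Q HY XY UY HQ A1 u uX [B0 uB0].
set B := sup _.
have uB n : fnorm X (u n) <= B.
  by apply: ub_le_sup; [exists B0 => _ [k _ <-]|exists n].
have B_ge0 : 0 <= B by exact: le_trans (fnorm_ge0 hXr (uX 0)) (uB 0).
have /choice[b ub] : forall n, exists b, expansion r psi X (u n) b.
  by move=> n; have [b [bn _]] := UX.1.2 _ (uX n); exists b.
have /choice[nu nuG] : forall n, exists nu : nat -> nabla d, greedy (b n) nu.
  by move=> n; exact: (greedy_exists hXr UX (uX n) (ub n)).
have [sg sgi [[dm dml] OM]] := extraction hXr UX nu uX uB ub.
pose u' n := u (sg n); pose b' n := b (sg n); pose nu' n := nu (sg n).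
have u'X n : fdom X (u' n) by exact: uX.
have u'B n : fnorm X (u' n) <= B by exact: uB.
have u'b n : expansion r psi X (u' n) (b' n) by exact: ub.
have nu'inj n : injective (nu' n) by case: (nuG (sg n)).
have /choice[phi Hphi] : forall l, exists phi, fdom X phi /\
    (fun M => fnorm X (partial r psi nu' dm l M - phi)) @ \oo --> (0 : R).
  move=> l; have [phi phiX phil] := partial_cvg hXr UX HD tau0 C10 HC1
    u'X u'B u'b nu'inj dml l hX.1.
  by exists phi.
have phiX l := (Hphi l).1; have phil l := (Hphi l).2.
have [DY HDY] := unconditional_constP HY (atom_dom UY) UY.
exists sg, phi, (profile_index R nu'); split.
- by split.
- apply: limn_esup_cvg0 => [L n|eps e0].
    apply: (fnorm_ge0 HY); apply: XY.1; apply: (fdomB hXr) => //.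
    by apply: (fdom_sum hXr) => l _; exact: (rescale_dom hXr).
  apply: (remainder_small hXr UX u'X u'b nu'inj dml phiX phil HY XY UY HDY) => //.
  move=> del del0; have [M0 HM0] := greedy_error hXr HY UX XY HQ A1 B del0.
  exists M0 => M n MM; exact: (HM0 M (u' n) (b' n) (nu' n) MM (u'X n) (u'B n) (u'b n) (nuG _)).
- by move=> k l; exact: profile_index_orthogonal.
- apply: lnorm_le => // [|l|L].
  + by rewrite !mulr_ge0 ?powR_ge0 ?HD.1.
  + exact: (fnorm_ge0 hXr).
  + rewrite -mulrA powRM ?powR_ge0 ?mulr_ge0 ?HD.1// -powRrM mulVf ?gt_eqF// powRr1//.
    exact: (profiles_stable hXr UX HD tau0 C10 HC1 u'X u'B u'b nu'inj dml phiX phil).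
Qed.
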